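(* Let $(\Omega,\mathcal{F},\mathbb{F},\mathbb{P})$ be a filtered probability space satisfying the usual conditions, with $\mathbb{F}=(\mathcal{F}_t)_{t\ge0}$ and $\mathcal{F}=\mathcal{F}_\infty$. Let $W$ be an $\mathbb{F}$-Brownian motion and let $Z=(Z_t)_{t\ge0}$ be an $\mathbb{F}$-adapted process taking values in $[0,1]$ and solving $$dZ_t=\sigma(Z_t)\,dW_t,\qquad Z_0=z\in[0,1],$$ where $\sigma:[0,1]\to[0,\infty)$ is continuous, strictly positive on $(0,1)$, and satisfies $\sigma(0)=\sigma(1)=0$. Then $Z$ is a continuous Bernoulli-Doob martingale: there exists a random variable $B\sim\mathrm{Ber}(z)$ on $(\Omega,\mathcal{F},\mathbb{P})$ such that $$Z_t=\mathbb{E}[B\mid\mathcal{F}_t]\quad\text{for all } t\ge0.$$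
   Context: $\mathrm{Ber}(z)$ is the law on $\{0,1\}$ with $\mathbb{P}(B=1)=z$. $\mathcal{F}_\infty$ is the $\sigma$-algebra generated by $\bigcup_{t\ge0}\mathcal{F}_t$ (suitably completed). A Bernoulli-Doob martingale is a process of the form $Z_t=\mathbb{E}[B\mid\mathcal{F}_t]$, where $B$ is a Bernoulli random variable and $(\mathcal{F}_t)_{t\ge 0}$ is a filtration satisfying the usual conditions. *)

(* Defs.v *)
From mathcomp Require Import all_boot all_order all_algebra.
From mathcomp Require Import all_classical all_reals all_analysis.

Set Implicit Arguments.
Unset Strict Implicit.
Unset Printing Implicit Defensive.

Import Order.TTheory GRing.Theory Num.Theory.
Import numFieldNormedType.Exports.

Local Open Scope classical_set_scope.
Local Open Scope ring_scope.

(* Time is a real number; every condition below concerns times t >= 0 only, so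
   the values of filtrations and processes at negative times play no role. *)

Section processes.
Context (d : measure_display) (T : measurableType d) (R : realType).
Implicit Types (P : probability T R) (F : R -> set (set T)) (X W H I : R -> T -> R).

Definition is_filtration F :=
  (forall t, 0 <= t -> sigma_algebra setT (F t)) /\
  (forall t, 0 <= t -> F t `<=` d.-measurable) /\
  (forall s t, 0 <= s -> s <= t -> F s `<=` F t).

(* P.-negligible A says that A is contained in a measurable P-null set, so the
   second clause implies that the measurable sets of T are P-complete too. *)
Definition usual_conditions P F :=
  [/\ is_filtration F,
      forall A, P.-negligible A -> F 0 A &
      forall t, 0 <= t -> \bigcap_(s in `]t, +oo[) F s = F t].

Definition sigma_infty F : set (set T) := <<s \bigcup_(t in `[0, +oo[) F t >>.

(* For a sigma-algebra G, the measurable sets of g_sigma_algebraType G are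
   exactly the members of G. *)
Definition measurable_wrt (G : set (set T)) (Y : T -> R) :=
  measurable_fun setT (Y : g_sigma_algebraType G -> R).

Definition adapted F X := forall t, 0 <= t -> measurable_wrt (F t) (X t).

Definition progressive F X := forall t, 0 <= t ->
  measurable_fun (`[0, t] `*` [set: g_sigma_algebraType (F t)])
    (fun x : R * g_sigma_algebraType (F t) => X x.1 x.2).

Definition continuous_path X (w : T) := {within `[0, +oo[, continuous (fun t => X t w)}.

Definition is_cond_exp P (G : set (set T)) (X Y : T -> R) :=
  [/\ measurable_wrt G Y,
      P.-integrable setT (EFin \o Y) &
      forall A, G A -> (\int[P]_(w in A) (Y w)%:E = \int[P]_(w in A) (X w)%:E)%E].

Definition increment W (s t : R) (w : T) : R := W t w - W s w.

(* The second parameter of normal_prob is the standard deviation. *)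
Definition brownian_motion P F W :=
  [/\ adapted F W,
      {ae P, forall w, W 0 w = 0},
      {ae P, forall w, continuous_path W w},
      (forall s t, 0 <= s -> s < t -> forall C : set R, measurable C ->
        P (increment W s t @^-1` C) = normal_prob 0 (Num.sqrt (t - s)) C) &
      (forall s t, 0 <= s -> s < t ->
        forall (A : set T) (C : set R), F s A -> measurable C ->
        P (A `&` increment W s t @^-1` C) = (P A * P (increment W s t @^-1` C))%E)].

(* The simple process
     sum_(i < sp_size) sp_coef i * 1_( ]sp_time i, sp_time (i+1)] ). *)
Record simple_process := SimpleProcess {
  sp_size : nat ;
  sp_time : nat -> R ;
  sp_coef : nat -> T -> R }.

Definition simple_predictable F (S : simple_process) :=
  [/\ 0 <= sp_time S 0,
      (forall i, (i < sp_size S)%N -> sp_time S i <= sp_time S i.+1),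
      (forall i, (i < sp_size S)%N ->
         measurable_wrt (F (sp_time S i)) (sp_coef S i)) &
      (forall i, (i < sp_size S)%N ->
         exists M : R, forall w, `|sp_coef S i w| <= M)].

Definition simple_eval (S : simple_process) (t : R) (w : T) : R :=
  \sum_(i < sp_size S)
    sp_coef S i w * \1_(`]sp_time S i, sp_time S i.+1]%classic) t.

Definition simple_integral W (S : simple_process) (t : R) (w : T) : R :=
  \sum_(i < sp_size S)
    sp_coef S i w * (W (Num.min (sp_time S i.+1) t) w
                   - W (Num.min (sp_time S i) t) w).

(* Both are squared distances, in L^2(P) and L^2([0, t] x Omega). *)
Definition sq_dist P (X Y : T -> R) : \bar R :=
  (\int[P]_w ((X w - Y w) ^+ 2)%:E)%E.

Definition sq_dist_upto P (t : R) (X Y : R -> T -> R) : \bar R :=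
  (\int[P]_w \int[lebesgue_measure]_(s in `[0%R, t])
     ((X s w - Y s w) ^+ 2)%:E)%E.

(* The L^2 construction of I_t = int_0^t H_s dW_s : H is approximated by simple
   processes in L^2([0, t] x Omega) for every t, and I is the continuous process
   to which their elementary integrals converge in L^2. By Ito's isometry, when
   W is a Brownian motion this determines I up to indistinguishability,
   independently of the approximating sequence. The first limit forces H to be
   square integrable on every [0, t] x Omega. *)
Definition is_ito_integral P F W H I :=
  [/\ progressive F H,
      adapted F I,
      (forall w, continuous_path I w) &
      exists S : nat -> simple_process,
        [/\ forall n, simple_predictable F (S n),
            forall t, 0 <= t ->
              sq_dist_upto P t (simple_eval (S n)) H @[n --> \oo] --> 0%E &
            forall t, 0 <= t ->
              sq_dist P (simple_integral W (S n) t) (I t)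
                @[n --> \oo] --> 0%E]].

(* dZ_t = sigma(Z_t) dW_t, Z_0 = z. The integrand is taken up to
   indistinguishability, so that Z itself need not be progressive (it is
   only almost surely equal to the continuous process z + I). *)
Definition solves_sde P F W (sigma : R -> R) (z : R) (Z : R -> T -> R) :=
  {ae P, forall w, Z 0 w = z} /\
  exists H I : R -> T -> R,
    [/\ {ae P, forall w, forall t, 0 <= t -> H t w = sigma (Z t w)},
        is_ito_integral P F W H I &
        {ae P, forall w, forall t, 0 <= t -> Z t w = Z 0 w + I t w}].

End processes.

(* Main.v *)
From HB Require Import structures.
Require Import Defs.
From mathcomp Require Import all_boot all_order all_algebra.
From mathcomp Require Import all_classical all_reals all_analysis.
From mathcomp Require Import measurable_realfun ring lra.
Set Implicit Arguments.
Unset Strict Implicit.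
Unset Printing Implicit Defensive.
Import Order.TTheory GRing.Theory Num.Theory.
Import numFieldNormedType.Exports.
Local Open Scope classical_set_scope.
Local Open Scope ring_scope.

(** Write e_t for the expectation of Z_t (1 - Z_t): it measures how far Z_t is
    from taking only the values 0 and 1.

    The stochastic integral of a bounded simple process is a martingale, and its
    second moment dominates a fixed multiple of the time-space energy of the
    integrand.  Both facts pass to the L^2 limit.  Hence Z is a martingale with
    values in [0, 1] ([diffusion_martingale]), and the energy
    E (int_0^t sigma(Z_s)^2 ds) stays below a constant that does not depend on t
    ([ito_integral_energy]).

    On [0, 1] the function x (1 - x) is at most e + C sigma(x)^2, for every
    e > 0 and a suitable C ([diffusion_controls_spread]), because sigma is
    bounded below on compact subsets of ]0, 1[.  As e_t is nonincreasing, a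
    value e_t > 2 e for large t would make the energy up to time t exceed the
    bound; so e_t tends to 0 ([diffusion_spread_small]).

    The limit B is built directly as an event.  Since E (Z_t - Z_s)^2 = e_s - e_t,
    the events Z_t > 1/2 change by a set of probability at most 6 e_s between s
    and t.
    Along times t_n with e_(t_n) <= 2^-n these changes are summable, so that the
    events stabilize almost surely and B, their limit superior, is
    exponentially close to the n-th one.  As Z_(t_n) is close in mean to the
    indicator of that event, the martingale property gives
    E (1_G Z_t) = P (G and B) for every G in F_t
    ([unit_interval_martingale_limit]).  With G the whole space and t = 0 this
    says that B has probability z.

    The energy bound may be off by any constant factor.  What the argument uses
    of the normal law of a Brownian increment is therefore that its mean
    vanishes and that its second moment is finite and at least k times the
    length of the time interval, for a fixed k > 0 ([normal_mean0],
    [normal_second_moment_lty], [normal_second_moment_ge]). *)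

(** * Moments of the centered normal law *)

Section normal_moments.
Context {R : realType}.
Local Notation mu := (@lebesgue_measure R).
Implicit Type s : R.

(** A Radon-Nikodym derivative is unique up to null sets, so the one for which
    change of variables is known can be replaced by the explicit density. *)
Lemma ge0_integral_normal_prob (m s : R) (f : R -> \bar R) :
  measurable_fun [set: R] f -> (forall x, 0 <= f x)%E ->
  (\int[normal_prob m s]_x f x =
   \int[mu]_x (f x * (normal_pdf m s x)%:E))%E.
Proof.
move=> mf f0.
have dom := normal_prob_dominates m s.
have mpdf : measurable_fun setT (EFin \o normal_pdf m s).
  by apply/measurable_EFinP; exact: measurable_normal_pdf.
rewrite -(Radon_Nikodym_SigmaFinite.change_of_variables dom)//.
apply: ge0_ae_eq_integral => //.
- apply: emeasurable_funM => //; apply: (measurable_int mu).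
  exact: Radon_Nikodym_SigmaFinite.f_integrable.
- exact: emeasurable_funM.
- by move=> x _; rewrite mule_ge0// Radon_Nikodym_SigmaFinite.f_ge0.
- by move=> x _; rewrite mule_ge0// lee_fin normal_pdf_ge0.
apply: ae_eqe_mul2l; apply: integral_ae_eq => //.
  exact: Radon_Nikodym_SigmaFinite.f_integrable.
by move=> E _ mE; rewrite -Radon_Nikodym_SigmaFinite.f_integral.
Qed.

(** With u = x^2 / (4 s^2) this is u exp(-u) <= 1: half of the exponent absorbs
    the square, and what remains is the density of a normal law whose variance
    is twice as large, hence integrable. *)
Lemma sqr_normal_fun_le s x : 0 < s ->
  x ^+ 2 * normal_fun 0 s x <=
  (s ^+ 2 *+ 4) * normal_fun 0 (Num.sqrt 2 * s) x.
Proof.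
move=> s0; rewrite /normal_fun subr0 exprMn sqr_sqrtr//.
have s20 : 0 < s ^+ 2 by rewrite exprn_gt0.
pose u := x ^+ 2 / (s ^+ 2 *+ 4).
have u0 : 0 <= u by rewrite divr_ge0 ?sqr_ge0// mulrn_wge0// ltW.
have -> : - x ^+ 2 / (s ^+ 2 *+ 2) = - u - u.
  by rewrite /u; field; rewrite gt_eqF.
have -> : - x ^+ 2 / ((2 * s ^+ 2) *+ 2) = - u.
  by rewrite /u; field; rewrite gt_eqF.
have -> : x ^+ 2 = (s ^+ 2 *+ 4) * u.
  by rewrite /u; field; rewrite gt_eqF.
rewrite expRD mulrA ler_wpM2r ?expR_ge0// -mulrA ler_piMr ?mulrn_wge0 ?(ltW s20)//.
rewrite expRN ler_pdivrMr ?expR_gt0// mul1r.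
by rewrite (le_trans _ (expR_ge1Dx u))// lerDr.
Qed.

Lemma normal_second_moment_lty s : 0 < s ->
  (\int[normal_prob 0 s]_x (x ^+ 2)%:E < +oo)%E.
Proof.
move=> s0; have s0' : s != 0 by rewrite gt_eqF.
have r0 : Num.sqrt 2 * s != 0 by rewrite gt_eqF// mulr_gt0// sqrtr_gt0.
rewrite ge0_integral_normal_prob//; last 2 first.
  by apply/measurable_EFinP; exact: exprn_measurable.
  by move=> x; rewrite lee_fin sqr_ge0.
(* The ratio of the peaks appears because the two laws are normalized
   differently. *)
pose c := s ^+ 2 *+ 4 * normal_peak s / normal_peak (Num.sqrt 2 * s).
have c0 : 0 <= c.
  by rewrite !mulr_ge0// ?invr_ge0 ?mulrn_wge0 ?sqr_ge0// normal_peak_ge0.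
apply: (@le_lt_trans _ _
    (\int[mu]_x (c%:E * (normal_pdf 0 (Num.sqrt 2 * s) x)%:E))%E).
  apply: ge0_le_integral => //.
  - by move=> x _; rewrite mule_ge0// lee_fin ?normal_pdf_ge0 ?sqr_ge0.
  - apply: emeasurable_funM; apply/measurable_EFinP.
      exact: exprn_measurable.
    exact: measurable_normal_pdf.
  - apply: emeasurable_funM; apply/measurable_EFinP => //.
    exact: measurable_normal_pdf.
  move=> x _; rewrite -!EFinM lee_fin !normal_pdfE//.
  rewrite [leRHS](_ : _ = normal_peak s *
    (s ^+ 2 *+ 4 * normal_fun 0 (Num.sqrt 2 * s) x)); last first.
    by rewrite /c; field; rewrite gt_eqF// normal_peak_gt0.
  by rewrite mulrCA ler_wpM2l ?normal_peak_ge0// sqr_normal_fun_le.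
rewrite ge0_integralZl//; last 2 first.
  by apply/measurable_EFinP; exact: measurable_normal_pdf.
  by move=> x _; rewrite lee_fin normal_pdf_ge0.
by rewrite integral_normal_pdf mule1 ltry.
Qed.

(** It is enough to integrate over [s, 2 s], an interval of length s on which x^2
    is at least s^2 and the density is of order 1/s. *)
Lemma normal_second_moment_ge : exists2 k : R, 0 < k &
  forall s, 0 < s -> ((k * s ^+ 2)%:E <= \int[normal_prob 0 s]_x (x ^+ 2)%:E)%E.
Proof.
pose k : R := normal_peak 1 * expR (- 2); exists k.
  by rewrite mulr_gt0 ?expR_gt0 ?normal_peak_gt0.
move=> s s0; have s0' : s != 0 by rewrite gt_eqF.
rewrite ge0_integral_normal_prob//; last 2 first.
  by apply/measurable_EFinP; exact: exprn_measurable.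
  by move=> x; rewrite lee_fin sqr_ge0.
pose c : R := normal_peak s * expR (- 2) * s ^+ 2.
have msqr : measurable_fun setT (fun x : R => ((x ^+ 2)%:E * (normal_pdf 0 s x)%:E)%E).
  apply: emeasurable_funM; apply/measurable_EFinP.
    exact: exprn_measurable.
  exact: measurable_normal_pdf.
apply: (@le_trans _ _ (\int[mu]_(x in `[s, (2 * s)%R]%classic) c%:E)%E).
  rewrite integral_cst//= lebesgue_measure_itv/= lte_fin ltr_pMl// ltr1n.
  (* The peak at s times s does not depend on s. *)
  rewrite -EFinB -EFinM lee_fin le_eqVlt; apply/orP; left; apply/eqP.
  rewrite /c /k /normal_peak expr1n mul1r -mulrnAr sqrtrM ?sqr_ge0// sqrtr_sqr.
  rewrite gtr0_norm//; field.
  by rewrite s0' gt_eqF// sqrtr_gt0 mulrn_wgt0// pi_gt0.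
apply: (@le_trans _ _ (\int[mu]_(x in `[s, (2 * s)%R]%classic)
    ((x ^+ 2)%:E * (normal_pdf 0 s x)%:E))%E); last first.
  apply: ge0_subset_integral => //.
  by move=> x _; rewrite mule_ge0// lee_fin ?normal_pdf_ge0 ?sqr_ge0.
apply: ge0_le_integral => //.
- by move=> x _; rewrite lee_fin /c mulr_ge0 ?sqr_ge0// mulr_ge0 ?expR_ge0 ?normal_peak_ge0.
- exact: measurable_funTS.
move=> x; rewrite /= in_itv/= => /andP[sx xs]; rewrite -EFinM lee_fin normal_pdfE//.
have x0 : 0 <= x by rewrite (le_trans (ltW s0)).
rewrite mulrC -mulrA /c -mulrA ler_wpM2l ?normal_peak_ge0//.
rewrite ler_pM ?expR_ge0 ?sqr_ge0//; last first.
  by rewrite ler_pXn2r// nnegrE// ltW.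
rewrite /normal_fun subr0 ler_expR mulNr lerN2 ler_pdivrMr; last first.
  by rewrite mulrn_wgt0// exprn_gt0.
rewrite (_ : 2 * _ = (2 * s) ^+ 2); last by ring.
by rewrite ler_pXn2r// nnegrE mulr_ge0// ltW.
Qed.

Lemma normal_fun0_opp s x : normal_fun 0 s (- x) = normal_fun 0 s x.
Proof. by rewrite /normal_fun !subr0 sqrrN. Qed.

Lemma integrable_normal_sqr s : 0 < s ->
  (normal_prob 0 s).-integrable setT (fun x : R => (x ^+ 2)%:E).
Proof.
move=> s0; apply/integrableP; split.
  by apply/measurable_EFinP; exact: exprn_measurable.
under eq_integral do rewrite gee0_abs ?lee_fin ?sqr_ge0//.
exact: normal_second_moment_lty.
Qed.

Lemma integrable_normal_id s : 0 < s ->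
  (normal_prob 0 s).-integrable setT (fun x : R => x%:E).
Proof.
move=> s0.
have i1 : (normal_prob 0 s).-integrable setT (fun x : R => (1 + x ^+ 2)%:E).
  apply: (@integrableD _ _ _ (normal_prob 0 s) setT measurableT
    (fun=> 1%:E) (fun x : R => (x ^+ 2)%:E)).
    exact: finite_measure_integrable_cst.
  exact: integrable_normal_sqr.
apply: (le_integrable measurableT _ _ i1) => [|x _].
  exact/measurable_EFinP.
rewrite lee_fin [leRHS]ger0_norm ?addr_ge0 ?sqr_ge0//.
by rewrite -(real_normK (num_real x)); have := sqr_ge0 (`|x| - 1); nra.
Qed.

(** The positive and negative parts of x have the same integral, by the
    substitution of -x for x in an even density. *)
Lemma normal_mean0 s : 0 < s -> (\int[normal_prob 0 s]_x x%:E = 0)%E.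
Proof.
move=> s0; have s0' : s != 0 by rewrite gt_eqF.
rewrite integralE.
have maxE (a : R -> R) : measurable_fun setT a ->
    (\int[normal_prob 0 s]_x maxe (a x)%:E 0 =
     \int[mu]_x (Num.max (a x) 0 * normal_pdf 0 s x)%:E)%E.
  move=> ma; rewrite ge0_integral_normal_prob//; last 2 first.
  - by apply: measurable_maxe => //; exact/measurable_EFinP.
  - by move=> x; rewrite le_max lexx orbT.
  by apply: eq_integral => x _; rewrite -EFin_max -EFinM.
have mid : measurable_fun setT (idfun : R -> R) by exact: measurable_id.
have mopp : measurable_fun setT (-%R : R -> R) by exact: oppr_measurable.
have finp : (\int[normal_prob 0 s]_x (EFin^\+ x))%E \is a fin_num.
  by apply: integrable_pos_fin_num => //; exact: integrable_normal_id.
suff -> : (\int[normal_prob 0 s]_x (EFin^\- x))%E = (\int[normal_prob 0 s]_x (EFin^\+ x))%E.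
  by rewrite subee.
transitivity (\int[mu]_x (Num.max (- x) 0 * normal_pdf 0 s x)%:E)%E.
  by rewrite -(maxE _ mopp); apply: eq_integral => x _; rewrite funenegE.
transitivity (\int[mu]_x (Num.max x 0 * normal_pdf 0 s x)%:E)%E; last first.
  by rewrite -(maxE _ mid); apply: eq_integral => x _; rewrite funeposE.
pose G (x : R) := Num.max (- x) 0 * normal_pdf 0 s x.
transitivity (\int[mu]_(x in `]-oo, (- 0)%R]) (G x)%:E)%E.
  rewrite [RHS]integral_mkcond; apply: eq_integral => x _; rewrite patchE.
  case: ifPn => //; rewrite notin_setE/= in_itv/= oppr0 => /negP; rewrite -ltNge => x0.
  by rewrite max_r ?mul0r// oppr_le0 ltW.
rewrite ge0_integration_by_substitutionNy; last 2 first.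
- apply: continuous_subspaceT => x; apply: cvgM; last exact: continuous_normal_pdf.
  apply: (@continuous_max _ _ (fun y : R => - y) (fun=> 0)).
    by apply: cvgN; exact: cvg_id.
  exact: cvg_cst.
- by move=> x _; rewrite mulr_ge0 ?normal_pdf_ge0// le_max lexx orbT.
rewrite [LHS]integral_mkcond; apply: eq_integral => x _; rewrite patchE.
rewrite /G /= !normal_pdfE// normal_fun0_opp opprK.
case: ifPn => //; rewrite notin_setE/= in_itv/= andbT => /negP; rewrite -ltNge => x0.
by rewrite max_r ?mul0r// ltW.
Qed.

End normal_moments.
(** * Integrable and square integrable random variables *)

Section integrable_variables.
Context d (T : measurableType d) (R : realType) (P : probability T R).
Implicit Types X Y : T -> R.

Lemma EFin_Rintegral X : P.-integrable setT (EFin \o X) ->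
  (\int[P]_w X w)%:E = (\int[P]_w (X w)%:E)%E.
Proof. by move=> iX; rewrite /Rintegral fineK// integrable_fin_num. Qed.

Lemma ae_eq_Rintegral X Y :
  measurable_fun setT X -> measurable_fun setT Y ->
  {ae P, forall w, X w = Y w} -> \int[P]_w X w = \int[P]_w Y w.
Proof.
move=> mX mY XY; congr fine; apply: ae_eq_integral => //; try exact/measurable_EFinP.
by apply: filterS XY => w /= ->.
Qed.

Lemma Rintegral_cst_probability (c : R) : \int[P]_w cst c w = c.
Proof.
rewrite Rintegral_cst// [X in fine X](_ : _ = 1%E) ?mulr1//.
exact: probability_setT.
Qed.

Lemma bounded_integrable (M : R) X : measurable_fun setT X ->
  (forall w, `|X w| <= M) -> P.-integrable setT (EFin \o X).
Proof.
move=> mX bX; apply: (le_integrable measurableT _ _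
  (finite_measure_integrable_cst P M measurableT)) => [|w _]; first exact/measurable_EFinP.
by rewrite lee_fin (le_trans (bX w))// ler_norm.
Qed.

Lemma dominated_integrable X Y : measurable_fun setT X ->
  (forall w, `|X w| <= Y w) -> P.-integrable setT (EFin \o Y) ->
  P.-integrable setT (EFin \o X).
Proof.
move=> mX XY iY; apply: (le_integrable measurableT _ _ iY) => [|w _].
  exact/measurable_EFinP.
by rewrite lee_fin (le_trans (XY w))// ler_norm.
Qed.

Lemma normr_indic_le1 (A : set T) w : `|\1_A w| <= 1 :> R.
Proof. by rewrite indicE; case: (_ \in _); rewrite ?normr1 ?normr0. Qed.

Lemma indic_integrable (A : set T) : measurable A ->
  P.-integrable setT (EFin \o (\1_A : T -> R)).
Proof.
move=> mA; apply: (@bounded_integrable 1); first exact: measurable_indic.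
exact: normr_indic_le1.
Qed.

Lemma probability_Rintegral (A : set T) : measurable A ->
  P A = (\int[P]_w \1_A w)%:E.
Proof.
move=> mA; rewrite EFin_Rintegral ?integral_indic ?setIT//.
exact: indic_integrable.
Qed.

Definition square_integrable X :=
  measurable_fun setT X /\ P.-integrable setT (fun w => (X w ^+ 2)%:E).

Lemma square_integrable_bounded (M : R) X : measurable_fun setT X ->
  (forall w, `|X w| <= M) -> square_integrable X.
Proof.
move=> mX bX; split=> //; apply: (@bounded_integrable (M ^+ 2)).
  exact: measurable_funX.
move=> w; rewrite normrX ler_pXn2r// nnegrE//.
by rewrite (le_trans _ (bX w)).
Qed.

(** The product is dominated by the sum of the squares. *)
Lemma square_integrableM X Y : square_integrable X -> square_integrable Y ->
  P.-integrable setT (EFin \o (X \* Y)%R).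
Proof.
move=> [mX iX] [mY iY]; apply: (@dominated_integrable _ (fun w => X w ^+ 2 + Y w ^+ 2)).
- exact: measurable_funM.
- move=> w; rewrite normrM -(real_normK (num_real (X w))) -(real_normK (num_real (Y w))).
  by have := sqr_ge0 (`|X w| - `|Y w|); have := normr_ge0 (X w); have := normr_ge0 (Y w); nra.
- exact: (integrableD measurableT iX iY).
Qed.

Lemma square_integrable_integrable X : square_integrable X ->
  P.-integrable setT (EFin \o X).
Proof.
move=> sX; have s1 : square_integrable (cst 1).
  by apply: (@square_integrable_bounded 1) => // w; rewrite normr1.
have := square_integrableM sX s1.
by apply: eq_integrable => // w _; rewrite /= mulr1.
Qed.

Lemma square_integrableD X Y : square_integrable X -> square_integrable Y ->
  square_integrable (X \+ Y).
Proof.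
move=> sX sY; have iXY := square_integrableM sX sY.
case: sX sY => [mX iX] [mY iY]; split; first exact: measurable_funD.
have := integrableD measurableT (integrableD measurableT iX iY)
  (integrableD measurableT iXY iXY).
apply: eq_integrable => // w _; rewrite /= -!EFinD; congr EFin; ring.
Qed.

End integrable_variables.

(** * Expectation of a product of independent variables *)

Section independent_product.
Context d (T : measurableType d) (R : realType) (P : probability T R).
Implicit Types X Y : T -> R.

Definition independent_pair X Y := forall A B : set R,
  measurable A -> measurable B ->
  P (X @^-1` A `&` Y @^-1` B) = (P (X @^-1` A) * P (Y @^-1` B))%E.

(** Independence says that the joint law and the product of the marginal laws
    agree on rectangles, so they coincide, and Fubini's theorem applies. *)
Lemma independent_pair_integralM X Y :
  measurable_fun setT X -> measurable_fun setT Y -> independent_pair X Y ->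
  P.-integrable setT (EFin \o X) -> P.-integrable setT (EFin \o Y) ->
  P.-integrable setT (fun w => (X w * Y w)%:E) /\
  (\int[P]_w (X w * Y w) = (\int[P]_w X w) * (\int[P]_w Y w))%R.
Proof.
move=> mX mY indXY iX iY.
pose X' : {RV P >-> R} := HB.pack X (isMeasurableFun.Build _ _ _ _ X mX).
pose Y' : {RV P >-> R} := HB.pack Y (isMeasurableFun.Build _ _ _ _ Y mY).
pose Z w := (X w, Y w).
have mZ : measurable_fun setT Z by exact: measurable_fun_pair.
pose Z' : {RV P >-> (R * R)%type} := HB.pack Z (isMeasurableFun.Build _ _ _ _ Z mZ).
pose PX := distribution P X'. pose PY := distribution P Y'.
have PZE : forall A, measurable A -> (PX \x PY)%E A = distribution P Z' A.
  apply: product_measure_unique => A B mA mB.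
  exact: indXY.
pose f (z : R * R) : \bar R := (z.1 * z.2)%:E.
have mf : measurable_fun setT f.
  by apply/measurable_EFinP; exact: measurable_funM.
have idist (V : {RV P >-> R}) : P.-integrable setT (EFin \o V) ->
    (distribution P V).-integrable setT (fun x : R => x%:E).
  move=> /integrableP[mV ?]; apply/integrableP; split; first exact/measurable_EFinP.
  rewrite ge0_integral_distribution//.
  by apply: measurableT_comp => //; exact/measurable_EFinP.
have finE (V : {RV P >-> R}) : P.-integrable setT (EFin \o V) ->
    (\int[distribution P V]_x x%:E = (\int[P]_w V w)%R%:E)%E.
  move=> iV; rewrite integral_distribution//.
  by rewrite EFin_Rintegral.
have iXY : (PX \x PY)%E.-integrable setT f.
  apply/integrable12ltyP => //=.
  under eq_integral => x _.
    under eq_integral do rewrite normrM EFinM.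
    rewrite ge0_integralZl//; last by apply/measurable_EFinP; exact: normr_measurable.
    over.
  have /integrableP[_ hX] := idist X' iX; have /integrableP[_ hY] := idist Y' iY.
  rewrite ge0_integralZr//; last 2 first.
    by apply/measurable_EFinP; exact: normr_measurable.
    by apply: integral_ge0.
  by rewrite lte_mul_pinfty// ?integral_ge0// ge0_fin_numE ?integral_ge0.
have intE (g : R * R -> \bar R) : (\int[distribution P Z']_z g z = \int[PX \x PY]_z g z)%E.
  by apply: eq_measure_integral => A mA _; exact/esym/PZE.
have iZ : P.-integrable setT (fun w => (X w * Y w)%:E).
  apply/integrableP; split.
    by apply/measurable_EFinP; exact: measurable_funM.
  move/integrableP : iXY => [_]; rewrite -intE.
  by rewrite ge0_integral_distribution//; exact: measurableT_comp.
split=> //.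
apply: EFin_inj; rewrite EFinM -!(finE X')// -(finE Y')//.
have fX : (\int[PX]_x x%:E)%E \is a fin_num by rewrite (finE X').
have fY : (\int[PY]_x x%:E)%E \is a fin_num by rewrite (finE Y').
transitivity (\int[PX]_x \int[PY]_y f (x, y))%E.
  rewrite EFin_Rintegral//; transitivity (\int[distribution P Z']_z f z)%E.
    by rewrite integral_distribution.
  by rewrite intE -integral12_prod_meas1.
transitivity (\int[PX]_x (x%:E * \int[PY]_y y%:E))%E.
  apply: eq_integral => x _; rewrite -integralZl//; last exact: idist.
rewrite -(fineK fY) integralZr//; last exact: idist.
Qed.

End independent_product.

(** * Measurability with respect to a sub-sigma-algebra *)

Section measurability_wrt.
Context d (T : measurableType d) (R : realType).
Implicit Types (G : set (set T)) (Y : T -> R).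

Lemma measurable_wrt_preimage G Y : sigma_algebra setT G ->
  measurable_wrt G Y -> forall C : set R, measurable C -> G (Y @^-1` C).
Proof.
move=> sG mY C mC; have := mY measurableT C mC.
by rewrite setTI -[X in X _ -> _]/(<<s G >>) sigma_algebra_id.
Qed.

Lemma measurable_wrtS G G' Y : G `<=` G' ->
  measurable_wrt G Y -> measurable_wrt G' Y.
Proof.
move=> GG' mY mT C mC; have := mY measurableT C mC.
exact: (@sub_sigma_algebra2 _ setT _ _ GG').
Qed.

Lemma measurable_wrt_measurable G Y : G `<=` d.-measurable ->
  measurable_wrt G Y -> measurable_fun setT Y.
Proof.
move=> Gm mY mT C mC; have := mY measurableT C mC.
by apply: smallest_sub => //; exact: sigma_algebra_measurable.
Qed.

Lemma measurable_wrt_indic G (A : set T) : G A -> measurable_wrt G (\1_A : T -> R).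
Proof.
move=> GA; apply: (@measurable_indic _ (g_sigma_algebraType G)).
exact: sub_sigma_algebra.
Qed.

End measurability_wrt.

(** * Brownian increments multiplied by a variable known beforehand *)

Section brownian_increments.
Context d (T : measurableType d) (R : realType) (P : probability T R).
Context (F : R -> set (set T)) (W : R -> T -> R).
Hypothesis filtF : is_filtration F.
Hypothesis bmW : brownian_motion P F W.

Lemma filtration_measurable t (Y : T -> R) : 0 <= t ->
  measurable_wrt (F t) Y -> measurable_fun setT Y.
Proof.
by move=> t0; apply: measurable_wrt_measurable; case: filtF => _ [+ _]; exact.
Qed.

Lemma filtration_wrtS s t (Y : T -> R) : 0 <= s -> s <= t ->
  measurable_wrt (F s) Y -> measurable_wrt (F t) Y.
Proof.
by move=> s0 st; apply: measurable_wrtS; case: filtF => _ [_ +]; exact.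
Qed.

Lemma increment_adapted s t : 0 <= s -> s <= t ->
  measurable_wrt (F t) (increment W s t).
Proof.
move=> s0 st; case: bmW => aW _ _ _ _; apply: measurable_funB.
  by apply: aW; exact: le_trans st.
by apply: (filtration_wrtS s0 st); exact: aW.
Qed.

Lemma increment_measurable s t : 0 <= s -> s <= t ->
  measurable_fun setT (increment W s t).
Proof.
move=> s0 st; apply: (@filtration_measurable t); first exact: le_trans st.
exact: increment_adapted.
Qed.

Lemma increment_independent s t (X : T -> R) (g : R -> R) : 0 <= s -> s < t ->
  measurable_wrt (F s) X -> measurable_fun setT g ->
  independent_pair P X (g \o increment W s t).
Proof.
move=> s0 st mX mg A B mA mB; case: bmW => _ _ _ _ ind.
rewrite comp_preimage; apply: ind => //.
  by apply: measurable_wrt_preimage => //; case: filtF => + _; exact.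
by rewrite -[_ @^-1` _]setTI; exact: mg.
Qed.

Lemma ge0_integral_increment s t (g : R -> \bar R) : 0 <= s -> s < t ->
  measurable_fun [set: R] g -> (forall x, 0 <= g x)%E ->
  (\int[P]_w g (increment W s t w) =
   \int[normal_prob 0 (Num.sqrt (t - s))]_x g x)%E.
Proof.
move=> s0 st mg g0; have mD := increment_measurable s0 (ltW st).
have mD' : measurable_fun setT (increment W s t : T -> measurableTypeR R) by exact: mD.
pose D : {RV P >-> measurableTypeR R} := HB.pack
  (increment W s t : T -> measurableTypeR R) (isMeasurableFun.Build _ _ _ _ _ mD').
transitivity (\int[distribution P D]_x g x)%E.
  by rewrite (ge0_integral_distribution D).
apply: eq_measure_integral => A mA _.
by case: bmW => _ _ _ + _; exact.
Qed.

Lemma increment_square_integrable s t : 0 <= s -> s < t ->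
  square_integrable P (increment W s t).
Proof.
move=> s0 st; have mD := increment_measurable s0 (ltW st).
split=> //; apply/integrableP; split.
  by apply/measurable_EFinP; exact: measurable_funX.
under eq_integral do rewrite gee0_abs ?lee_fin ?sqr_ge0//.
rewrite (@ge0_integral_increment _ _ (fun x => (x ^+ 2)%:E))//.
- by apply: normal_second_moment_lty; rewrite sqrtr_gt0 subr_gt0.
- by apply/measurable_EFinP; exact: exprn_measurable.
- by move=> x; rewrite lee_fin sqr_ge0.
Qed.

Lemma increment_mean0 s t : 0 <= s -> s < t ->
  \int[P]_w (increment W s t w) = 0.
Proof.
move=> s0 st; have mD := increment_measurable s0 (ltW st).
have mD' : measurable_fun setT (increment W s t : T -> measurableTypeR R) by exact: mD.
pose D : {RV P >-> measurableTypeR R} := HB.pack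
  (increment W s t : T -> measurableTypeR R) (isMeasurableFun.Build _ _ _ _ _ mD').
have iD : P.-integrable setT (EFin \o D).
  by apply: square_integrable_integrable; exact: increment_square_integrable.
apply: EFin_inj; rewrite EFin_Rintegral//.
transitivity (\int[distribution P D]_x x%:E)%E.
  by rewrite integral_distribution.
rewrite -[RHS](@normal_mean0 _ (Num.sqrt (t - s))); last by rewrite sqrtr_gt0 subr_gt0.
apply: eq_measure_integral => A mA _.
by case: bmW => _ _ _ + _; exact.
Qed.

Context (k : R).
Hypothesis kP : forall s, 0 < s ->
  ((k * s ^+ 2)%:E <= \int[normal_prob 0 s]_x (x ^+ 2)%:E)%E.

Lemma increment_variance_ge s t : 0 <= s -> s < t ->
  k * (t - s) <= \int[P]_w (increment W s t w ^+ 2).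
Proof.
move=> s0 st; have [_ iD] := increment_square_integrable s0 st.
have st0 : 0 < t - s by rewrite subr_gt0.
rewrite -lee_fin EFin_Rintegral//.
rewrite (@ge0_integral_increment _ _ (fun x => (x ^+ 2)%:E))//.
- have := @kP (Num.sqrt (t - s)); rewrite sqrtr_gt0 => /(_ st0).
  by rewrite sqr_sqrtr// ltW.
- by apply/measurable_EFinP; exact: exprn_measurable.
- by move=> x; rewrite lee_fin sqr_ge0.
Qed.

(** X is independent of the increment, which has mean zero. *)
Lemma martingale_increment s t (X : T -> R) : 0 <= s -> s <= t ->
  measurable_wrt (F s) X -> P.-integrable setT (EFin \o X) ->
  P.-integrable setT (fun w => (X w * increment W s t w)%:E) /\
  \int[P]_w (X w * increment W s t w) = 0.
Proof.
move=> s0; rewrite le_eqVlt => /predU1P[<- _ _|st mX iX].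
  have E0 w : X w * increment W s s w = 0 by rewrite /increment subrr mulr0.
  split; first by under eq_fun do rewrite E0; exact: integrable0.
  by under eq_Rintegral do rewrite E0; rewrite Rintegral_cst// mul0r.
have ind := increment_independent s0 st mX (@measurable_id _ _ _).
have [] := independent_pair_integralM _ _ ind iX _.
- exact: (filtration_measurable s0 mX).
- exact: increment_measurable (ltW st).
- exact/square_integrable_integrable/increment_square_integrable.
by move=> ? ->; rewrite increment_mean0// mulr0.
Qed.

(** X^2 is independent of the squared increment, so the expectation of their
    product factorizes. *)
Lemma increment_transform_energy s t (X : T -> R) : 0 <= s -> s <= t ->
  measurable_wrt (F s) X -> square_integrable P X ->
  square_integrable P (fun w => X w * increment W s t w) /\
  k * (\int[P]_w (X w ^+ 2) * (t - s)) <=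
    \int[P]_w ((X w * increment W s t w) ^+ 2).
Proof.
move=> s0 st mX sX; have mXT := filtration_measurable s0 mX.
have mD := increment_measurable s0 st.
have mXD : measurable_fun setT (fun w => X w * increment W s t w).
  exact: measurable_funM.
move: st; rewrite le_eqVlt => /predU1P[st|st].
  have E0 w : (X w * increment W s t w) ^+ 2 = 0.
    by rewrite /increment st subrr mulr0 expr0n.
  split; first by split=> //; under eq_fun do rewrite E0; exact: integrable0.
  under [leRHS]eq_Rintegral do rewrite E0.
  by rewrite Rintegral_cst// mul0r st subrr !mulr0.
have m2 : measurable_fun setT (fun x : R => x ^+ 2) by exact: exprn_measurable.
have mX2 : measurable_wrt (F s) (fun w => X w ^+ 2) by exact: measurable_funX.
have ind := increment_independent s0 st mX2 m2.
have [] := independent_pair_integralM _ _ ind _ _.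
- exact: measurable_funX.
- exact: measurable_funX.
- by case: sX.
- by case: (increment_square_integrable s0 st).
move=> i e; split.
  by split=> //; apply: eq_integrable i => // w _; rewrite /= exprMn.
under [leRHS]eq_Rintegral do rewrite exprMn.
rewrite e mulrCA ler_wpM2l//; last exact: increment_variance_ge.
by apply: Rintegral_ge0 => w _; rewrite sqr_ge0.
Qed.

End brownian_increments.

(** * Stochastic integrals of simple processes *)

Section simple_integrals.
Context d (T : measurableType d) (R : realType) (P : probability T R).
Context (F : R -> set (set T)) (W : R -> T -> R) (k : R).
Hypothesis filtF : is_filtration F.
Hypothesis bmW : brownian_motion P F W.
Hypothesis kP : forall s, 0 < s ->
  ((k * s ^+ 2)%:E <= \int[normal_prob 0 s]_x (x ^+ 2)%:E)%E.

(** The energy of an integral grows step by step: the cross term vanishes because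
    M a is known at time u while the increment that multiplies it is not. *)
Lemma add_increment_energy u v (M a : T -> R) : 0 <= u -> u <= v ->
  measurable_wrt (F u) M -> measurable_wrt (F u) a ->
  square_integrable P M -> square_integrable P a ->
  square_integrable P (fun w => M w + a w * increment W u v w) /\
  \int[P]_w (M w ^+ 2) + k * (\int[P]_w (a w ^+ 2) * (v - u)) <=
    \int[P]_w ((M w + a w * increment W u v w) ^+ 2).
Proof.
move=> u0 uv mM ma sM sa.
have [saD enD] := increment_transform_energy filtF bmW kP u0 uv ma sa.
split; first exact: square_integrableD.
have mMa : measurable_wrt (F u) (M \* a) by exact: measurable_funM.
have [iMaD MaD0] := martingale_increment filtF bmW u0 uv mMa (square_integrableM sM sa).
have [_ iM] := sM; have [_ iaD] := saD.
rewrite (_ : \int[P]_w ((M w + a w * increment W u v w) ^+ 2) =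
  \int[P]_w (M w ^+ 2) + 2 * \int[P]_w ((M \* a) w * increment W u v w) +
  \int[P]_w ((a w * increment W u v w) ^+ 2)).
  by rewrite MaD0 mulr0 addr0 lerD2l.
rewrite -RintegralZl// -RintegralD//; last exact: integrableZl iMaD.
rewrite -RintegralD//; last first.
  exact: (integrableD measurableT iM (integrableZl measurableT 2 iMaD)).
by apply: eq_Rintegral => w _ /=; ring.
Qed.

(** A coefficient that becomes known only after t multiplies an increment that
    vanishes once it is stopped at t.  Replacing such a coefficient by 0 changes
    no product and makes every coefficient known at the stopped time. *)
Definition truncated_coef (S : simple_process T R) t i w : R :=
  if sp_time S i <= t then sp_coef S i w else 0.

Definition partial_integral (S : simple_process T R) n t w : R :=
  \sum_(i < n) sp_coef S i w *
    increment W (Num.min (sp_time S i) t) (Num.min (sp_time S i.+1) t) w.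

Definition partial_variation (S : simple_process T R) n t w : R :=
  \sum_(i < n) sp_coef S i w ^+ 2 *
    (Num.min (sp_time S i.+1) t - Num.min (sp_time S i) t).

Variable S : simple_process T R.
Hypothesis predS : simple_predictable F S.

Lemma sp_time_ge0 i : (i <= sp_size S)%N -> 0 <= sp_time S i.
Proof.
case: predS => t0 tS _ _; elim: i => // i IH iS.
by rewrite (le_trans (IH (ltnW iS)))// tS.
Qed.

Lemma sp_time_le i j : (i <= j)%N -> (j <= sp_size S)%N ->
  sp_time S i <= sp_time S j.
Proof.
case: predS => _ tS _ _; elim: j => [|j IH]; first by rewrite leqn0 => /eqP->.
rewrite leq_eqVlt => /predU1P[->//|ij jS].
by rewrite (le_trans (IH ij (ltnW jS)))// tS.
Qed.

Lemma sp_coef_bounded i : (i < sp_size S)%N ->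
  exists M : R, forall w, `|sp_coef S i w| <= M.
Proof. by case: predS => _ _ _; exact. Qed.

Lemma truncated_coefE t i w x : (t < sp_time S i -> x = 0) ->
  sp_coef S i w * x = truncated_coef S t i w * x.
Proof.
move=> x0; rewrite /truncated_coef; case: leP => // /x0 ->.
by rewrite !mulr0.
Qed.

Lemma truncated_coef_measurable t i : 0 <= t -> (i < sp_size S)%N ->
  measurable_wrt (F (Num.min (sp_time S i) t)) (truncated_coef S t i).
Proof.
move=> t0 iS; have ti0 := sp_time_ge0 (ltnW iS); rewrite /truncated_coef.
case: leP => ti; last exact: measurable_cst.
by case: predS => _ _ + _; exact.
Qed.

Lemma truncated_coef_bounded t i : (i < sp_size S)%N ->
  exists M : R, forall w, `|truncated_coef S t i w| <= M.
Proof.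
move=> iS; have [M HM] := sp_coef_bounded iS; exists `|M| => w.
rewrite /truncated_coef; case: ifP => _; last by rewrite normr0.
by rewrite (le_trans (HM w))// ler_norm.
Qed.

Lemma truncated_coef_square_integrable t i : 0 <= t -> (i < sp_size S)%N ->
  square_integrable P (truncated_coef S t i).
Proof.
move=> t0 iS; have [M HM] := truncated_coef_bounded t iS.
apply: square_integrable_bounded HM.
apply: (filtration_measurable filtF _ (truncated_coef_measurable t0 iS)).
by rewrite le_min t0 sp_time_ge0// ltnW.
Qed.

Lemma min_time_le t i : (i < sp_size S)%N ->
  Num.min (sp_time S i) t <= Num.min (sp_time S i.+1) t.
Proof. by move=> iS; rewrite le_min2// sp_time_le. Qed.

Lemma min_time_gt t i : (i < sp_size S)%N -> t < sp_time S i ->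
  Num.min (sp_time S i) t = t /\ Num.min (sp_time S i.+1) t = t.
Proof.
move=> iS ti; rewrite !min_r ?(ltW ti)//.
by rewrite (le_trans (ltW ti))// sp_time_le.
Qed.

Lemma partial_integral_energy n t : 0 <= t -> (n <= sp_size S)%N ->
  [/\ measurable_wrt (F (Num.min (sp_time S n) t)) (partial_integral S n t),
      square_integrable P (partial_integral S n t),
      P.-integrable setT (EFin \o partial_variation S n t) &
      k * \int[P]_w partial_variation S n t w <=
        \int[P]_w (partial_integral S n t w ^+ 2)].
Proof.
move=> t0; elim: n => [|n IH] nS.
  have p0 : partial_integral S 0 t = cst 0.
    by apply/funext => w; rewrite /partial_integral big_ord0.
  have v0 : partial_variation S 0 t = cst 0.
    by apply/funext => w; rewrite /partial_variation big_ord0.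
  rewrite p0 v0; split.
  - exact: measurable_cst.
  - by apply: (@square_integrable_bounded _ _ _ _ 0) => // w; rewrite normr0.
  - exact: integrable0.
  - under [leRHS]eq_Rintegral do rewrite /= expr0n/=.
    by rewrite !Rintegral_cst// mul0r mulr0.
have [mM sM iV enM] := IH (ltnW nS).
have u0 : 0 <= Num.min (sp_time S n) t by rewrite le_min t0 sp_time_ge0// ltnW.
have uv := min_time_le t nS.
set u := Num.min (sp_time S n) t in mM u0 uv *.
set v := Num.min (sp_time S n.+1) t in uv *.
have ma := truncated_coef_measurable t0 nS; rewrite -/u in ma.
have sa := truncated_coef_square_integrable t0 nS.
have [sMa enMa] := add_increment_energy u0 uv mM ma sM sa.
have pE : partial_integral S n.+1 t =
    (fun w => partial_integral S n t w + truncated_coef S t n w * increment W u v w).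
  apply/funext => w; rewrite /partial_integral big_ord_recr/=; congr +%R.
  apply: truncated_coefE => tn; rewrite -/u -/v.
  by rewrite /u /v; have [-> ->] := min_time_gt nS tn; rewrite /increment subrr.
have vE : partial_variation S n.+1 t =
    (fun w => partial_variation S n t w + (v - u) * truncated_coef S t n w ^+ 2).
  apply/funext => w; rewrite /partial_variation big_ord_recr/=; congr +%R.
  rewrite -/u -/v mulrC /truncated_coef; case: leP => // tn.
  by rewrite /u /v; have [-> ->] := min_time_gt nS tn; rewrite subrr !mul0r.
have [_ ia] := sa.
have ia' : P.-integrable setT (fun w => ((v - u) * truncated_coef S t n w ^+ 2)%:E).
  exact: (integrableZl measurableT (v - u) ia).
rewrite pE vE; split => //.
- apply: measurable_funD; first exact: (filtration_wrtS filtF u0 uv).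
  apply: measurable_funM; first exact: (filtration_wrtS filtF u0 uv).
  exact: (increment_adapted filtF bmW u0 uv).
- exact: (integrableD measurableT iV ia').
- rewrite RintegralD// RintegralZl// mulrDr (le_trans _ enMa)// lerD//.
  by rewrite [X in k * X]mulrC.
Qed.

End simple_integrals.

Section simple_time_integral.
Context d (T : measurableType d) (R : realType) (F : R -> set (set T)).
Variable S : simple_process T R.
Hypothesis predS : simple_predictable F S.

Lemma setI_time_interval (a b t : R) : 0 <= a ->
  `]a, b] `&` `[0, t] = `]Num.min a t, Num.min b t]%classic.
Proof.
move=> a0; apply/seteqP; split => x /=; rewrite !in_itv/=.
  by move=> [/andP[ax xb] /andP[x0 xt]]; rewrite le_min xb xt gt_min ax.
rewrite le_min gt_min => /andP[/orP[ax|tx] /andP[xb xt]].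
  by rewrite ax xb xt (le_trans a0 (ltW ax)).
by move: xt; rewrite leNgt tx.
Qed.

Lemma integral_time_step (a b c t : R) : 0 <= a -> a <= b ->
  (\int[lebesgue_measure]_(s in `[0%R, t]) (c ^+ 2 * \1_(`]a, b]%classic) s)%:E =
   (c ^+ 2 * (Num.min b t - Num.min a t))%:E)%E.
Proof.
move=> a0 ab; under eq_integral do rewrite EFinM.
rewrite ge0_integralZl//; last 2 first.
- by apply/measurable_EFinP; exact: measurable_indic.
- by rewrite lee_fin sqr_ge0.
rewrite integral_indic//= setI_time_interval// lebesgue_measure_itv/= lte_fin.
case: ifPn; first by rewrite -EFinB -EFinM.
rewrite -leNgt => le; suff -> : Num.min b t = Num.min a t by rewrite subrr mulr0 mule0.
by apply/eqP; rewrite eq_le le le_min2.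
Qed.

(** The intervals of a simple process are disjoint, so no cross term survives. *)
Lemma sqr_partial_eval n s w : (n <= sp_size S)%N ->
  (\sum_(i < n) sp_coef S i w * \1_(`]sp_time S i, sp_time S i.+1]%classic) s) ^+ 2 =
  \sum_(i < n) sp_coef S i w ^+ 2 * \1_(`]sp_time S i, sp_time S i.+1]%classic) s.
Proof.
elim: n => [|n IH] nS; first by rewrite !big_ord0 expr0n.
rewrite !big_ord_recr/= sqrrD -IH ?(ltnW nS)//.
have [sn|sn] := boolP (s \in `]sp_time S n, sp_time S n.+1]%classic); last first.
  by rewrite indicE (negbTE sn) !mulr0 mul0rn expr0n/= !addr0.
rewrite big1 => [|i _]; first by rewrite expr0n/= mul0r mul0rn !add0r indicE sn !mulr1.
rewrite indicE memNset ?mulr0//= in_itv/= => /andP[_ si].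
move: sn; rewrite inE/= in_itv/= => /andP[+ _]; rewrite ltNge => /negP; apply.
by rewrite (le_trans si)//; apply: (sp_time_le predS); [exact: ltn_ord|exact: ltnW].
Qed.

Lemma integral_sqr_simple_eval t w :
  (\int[lebesgue_measure]_(s in `[0%R, t]) (simple_eval S s w ^+ 2)%:E =
   (partial_variation S (sp_size S) t w)%:E)%E.
Proof.
under eq_integral do rewrite /simple_eval sqr_partial_eval// -sumEFin.
rewrite ge0_integral_sum//; last 2 first.
- move=> i; apply/measurable_EFinP/measurable_funM => //.
- by move=> i s _; rewrite lee_fin mulr_ge0// sqr_ge0.
rewrite /partial_variation -sumEFin; apply: eq_bigr => i _.
rewrite integral_time_step//; first by apply: (sp_time_ge0 predS); exact/ltnW.
by apply: (sp_time_le predS).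
Qed.

End simple_time_integral.

Section simple_martingale.
Context d (T : measurableType d) (R : realType) (P : probability T R).
Context (F : R -> set (set T)) (W : R -> T -> R).
Hypothesis filtF : is_filtration F.
Hypothesis bmW : brownian_motion P F W.
Variable S : simple_process T R.
Hypothesis predS : simple_predictable F S.

(** The part of the stopped increment that accrues between s and t is the
    increment over the interval clipped to [s, t]. *)
Lemma increment_min_sub (a b s t : R) w : a <= b -> s <= t ->
  increment W (Num.min a t) (Num.min b t) w -
  increment W (Num.min a s) (Num.min b s) w =
  increment W (Num.max s (Num.min a t)) (Num.max s (Num.min b t)) w.
Proof.
move=> ab st; rewrite /increment.
have E c : W (Num.min c t) w - W (Num.min c s) w = W (Num.max s (Num.min c t)) w - W s w.
  have [cs|sc] := leP c s.
    by rewrite (min_l (le_trans cs st)) max_l// !subrr.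
  by rewrite (@max_r _ _ s)// le_min st ltW.
by have := E a; have := E b; lra.
Qed.

(** A multiplier Y rather than the indicator of an event is needed, because the
    spread of a martingale X is controlled by testing with Y = X_s. *)
Lemma simple_martingale_step s t (Y : T -> R) i :
  0 <= s -> s <= t -> measurable_wrt (F s) Y -> (forall w, `|Y w| <= 1) ->
  (i < sp_size S)%N ->
  let D w := sp_coef S i w *
    (increment W (Num.min (sp_time S i) t) (Num.min (sp_time S i.+1) t) w -
     increment W (Num.min (sp_time S i) s) (Num.min (sp_time S i.+1) s) w) in
  P.-integrable setT (fun w => (Y w * D w)%:E) /\
  \int[P]_w (Y w * D w) = 0.
Proof.
move=> s0 st mY Y1 iS D; have t0 := le_trans s0 st.
have ti0 := sp_time_ge0 predS (ltnW iS).
have titi : sp_time S i <= sp_time S i.+1 by apply: (sp_time_le predS).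
set a := sp_time S i in ti0 titi; set b := sp_time S i.+1 in titi.
pose u := Num.max s (Num.min a t); pose v := Num.max s (Num.min b t).
pose X w := Y w * truncated_coef S t i w.
have su : s <= u by rewrite le_max lexx.
have u0 : 0 <= u := le_trans s0 su.
have uv : u <= v by rewrite ge_max !le_max lexx/= le_min2 ?orbT.
have DE w : Y w * D w = X w * increment W u v w.
  rewrite /D -/a -/b increment_min_sub// -/u -/v /X -mulrA; congr *%R.
  apply: truncated_coefE => ta.
  rewrite /u /v !(@min_r _ _ _ t) ?ltW//; last exact: lt_le_trans titi.
  by rewrite /increment subrr.
have mX : measurable_wrt (F u) X.
  apply: measurable_funM.
    exact: (filtration_wrtS filtF s0 su).
  apply: (filtration_wrtS filtF _ _ (truncated_coef_measurable predS t0 iS)).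
    by rewrite le_min ti0.
  by rewrite le_max lexx orbT.
have iX : P.-integrable setT (EFin \o X).
  have [M HM] := truncated_coef_bounded predS t iS.
  apply: (@bounded_integrable _ _ _ _ M); first exact: (filtration_measurable filtF u0 mX).
  by move=> w; rewrite /X normrM -[M]mul1r ler_pM.
have [iXD XD0] := martingale_increment filtF bmW u0 uv mX iX.
split; first by under eq_fun do rewrite DE.
by under eq_Rintegral do rewrite DE.
Qed.

Lemma simple_integral_martingale s t (Y : T -> R) :
  0 <= s -> s <= t -> measurable_wrt (F s) Y -> (forall w, `|Y w| <= 1) ->
  P.-integrable setT
    (fun w => (Y w * (simple_integral W S t w - simple_integral W S s w))%:E) /\
  \int[P]_w (Y w * (simple_integral W S t w - simple_integral W S s w)) = 0.
Proof.
move=> s0 st mY Y1.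
suff H n : (n <= sp_size S)%N ->
    P.-integrable setT
      (fun w => (Y w * (partial_integral W S n t w - partial_integral W S n s w))%:E) /\
    \int[P]_w (Y w * (partial_integral W S n t w - partial_integral W S n s w)) = 0.
  exact: H.
elim: n => [|n IH] nS.
  have E0 w : Y w * (partial_integral W S 0 t w - partial_integral W S 0 s w) = 0.
    by rewrite /partial_integral !big_ord0 subrr mulr0.
  split; first by under eq_fun do rewrite E0; exact: integrable0.
  by under eq_Rintegral do rewrite E0; rewrite Rintegral_cst// mul0r.
have [i0 e0] := IH (ltnW nS).
have [i1 e1] := simple_martingale_step s0 st mY Y1 nS.
have E w : Y w * (partial_integral W S n.+1 t w - partial_integral W S n.+1 s w) =
    Y w * (partial_integral W S n t w - partial_integral W S n s w) +
    Y w * (sp_coef S n w *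
    (increment W (Num.min (sp_time S n) t) (Num.min (sp_time S n.+1) t) w -
     increment W (Num.min (sp_time S n) s) (Num.min (sp_time S n.+1) s) w)).
  by rewrite /partial_integral !big_ord_recr/=; ring.
split; first by under eq_fun do rewrite E; exact: (integrableD measurableT i0 i1).
by under eq_Rintegral do rewrite E; rewrite RintegralD// e0 e1 addr0.
Qed.

Lemma simple_integral_square_integrable t : 0 <= t ->
  square_integrable P (simple_integral W S t).
Proof.
move=> t0; have [k _ kP] := @normal_second_moment_ge R.
by have [_ + _ _] := partial_integral_energy filtF bmW kP predS t0 (leqnn _).
Qed.

Lemma simple_integral_energy (k t : R) :
  (forall s, 0 < s ->
    ((k * s ^+ 2)%:E <= \int[normal_prob 0 s]_x (x ^+ 2)%:E)%E) ->
  0 <= t ->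
  (k%:E * \int[P]_w \int[lebesgue_measure]_(s in `[0%R, t])
      (simple_eval S s w ^+ 2)%:E <=
   \int[P]_w (simple_integral W S t w ^+ 2)%:E)%E.
Proof.
move=> kP t0.
have [_ [_ iM] iV en] := partial_integral_energy filtF bmW kP predS t0 (leqnn _).
under eq_integral do rewrite (integral_sqr_simple_eval predS).
by rewrite -EFin_Rintegral// -EFinM -EFin_Rintegral.
Qed.

End simple_martingale.

(** * Integration over time and space *)

Section time_space_integrals.
Context d (T : measurableType d) (R : realType) (P : probability T R).
Context (F : R -> set (set T)).
Hypothesis filtF : is_filtration F.
Local Notation mu := (@lebesgue_measure R).

(** The identity from T to the same set with the smaller sigma-algebra F_t is
    measurable. *)
Lemma progressive_measurable (H : R -> T -> R) (t : R) : 0 <= t -> progressive F H ->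
  measurable_fun (`[0, t] `*` [set: T]) (fun x : R * T => H x.1 x.2).
Proof.
move=> t0 pH.
pose id' (x : R * T) : R * g_sigma_algebraType (F t) := (x.1, x.2).
have mid : measurable_fun setT id'.
  apply: measurable_fun_pair; first exact: measurable_fst.
  move=> _ A mA; rewrite setTI.
  suff mA' : d.-measurable A by rewrite -[_ @^-1` _]setTI; exact: measurable_snd.
  move: A mA; apply: smallest_sub; first exact: sigma_algebra_measurable.
  by case: filtF => _ [+ _]; exact.
have mid' : measurable_fun (`[0, t] `*` [set: T]) id' by exact: measurable_funTS mid.
suff h : measurable_fun (`[0, t] `*` [set: T])
  ((fun x : R * g_sigma_algebraType (F t) => H x.1 x.2) \o id') by exact: h.
apply: (measurable_comp _ _ (pH t t0) mid').
- by apply: measurableX.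
- by move=> _ [[s w] [/= st _] <-].
Qed.

Lemma simple_eval_measurable (S : simple_process T R) : simple_predictable F S ->
  measurable_fun setT (fun x : R * T => simple_eval S x.1 x.2).
Proof.
move=> predS; apply: measurable_sum => i.
apply: measurable_funM; last exact: measurableT_comp.
apply: measurableT_comp => //; case: (predS) => _ _ + _ => /(_ i (ltn_ord i)).
apply: (filtration_measurable filtF); apply: (sp_time_ge0 predS); exact/ltnW.
Qed.

(** Extending f by 0 outside the slab reduces this to Tonelli's theorem on the
    whole product. *)
Lemma fubini_tonelli_slab (t : R) (f : R * T -> \bar R) :
  measurable_fun (`[0, t] `*` [set: T]) f -> (forall x, 0 <= f x)%E ->
  [/\ measurable_fun setT (fun w => \int[mu]_(s in `[0%R, t]) f (s, w))%E,
      measurable_fun `[0, t] (fun s => \int[P]_w f (s, w))%E &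
      (\int[P]_w \int[mu]_(s in `[0%R, t]) f (s, w) =
       \int[mu]_(s in `[0%R, t]) \int[P]_w f (s, w))%E].
Proof.
move=> mf f0; have mD : measurable (`[0, t] `*` [set: T] : set (R * T)).
  exact: measurableX.
pose g : measurableTypeR R * T -> \bar R := f \_ (`[0, t] `*` [set: T]).
have mg : measurable_fun setT g by have h := (measurable_restrictT f mD).1 mf; exact: h.
have g0 x : (0 <= g x)%E by rewrite /g; apply: erestrict_ge0.
have gE s w : g (s, w) = ((fun s => f (s, w)) \_ `[0, t]) s.
  rewrite /g !patchE; congr (if _ then _ else _).
  by apply/idP/idP; rewrite !inE/=; [case|move=> ?; split].
have gE' s : (\int[P]_w g (s, w) = ((fun s => \int[P]_w f (s, w)) \_ `[0%R, t]) s)%E.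
  rewrite patchE; under eq_integral do rewrite gE patchE.
  by case: ifP => // _; rewrite integral0.
have := @measurable_fun_fubini_tonelli_G _ _ _ _ _ mu g mg g0.
have := @measurable_fun_fubini_tonelli_F _ _ _ _ _ P g mg g0.
have := @fubini_tonelli _ _ _ _ _ mu P g mg g0.
rewrite /fubini_F /fubini_G => e mF mG; split.
- by under eq_fun do [rewrite integral_mkcond; under eq_integral do rewrite -gE].
- apply/(measurable_restrictT _ _) => //.
  rewrite [X in measurable_fun _ X](_ : _ = fun s => \int[P]_w g (s, w))%E; first exact: mF.
  by apply/funext => s; rewrite gE'.
rewrite [RHS]integral_mkcond; under [RHS]eq_integral do rewrite -gE'.
rewrite e; apply: eq_integral => w _; rewrite integral_mkcond.
by apply: eq_integral => s _; rewrite gE.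
Qed.

Lemma section_measurable (t s : R) (f : R * T -> \bar R) :
  measurable_fun (`[0, t] `*` [set: T]) f -> s \in `[0, t] ->
  measurable_fun setT (fun w => f (s, w)).
Proof.
move=> mf st; apply: (measurable_comp (F := `[0, t] `*` setT) _ _ mf) => //.
- exact: measurableX.
- by move=> _ [w _ <-].
Qed.

Lemma slab_measurable_time (t : R) (f : R * T -> \bar R) w :
  measurable_fun (`[0, t] `*` [set: T]) f ->
  measurable_fun `[0, t] (fun s => f (s, w)).
Proof.
move=> mf; apply: (measurable_comp (F := `[0, t] `*` setT) _ _ mf) => //.
- exact: measurableX.
- by move=> _ [s st <-].
- exact: measurable_funTS.
Qed.

Lemma ge0_integral2D d' (T' : measurableType d') (m : {measure set T' -> \bar R})
    (D : set T') (a b : T' -> \bar R) : measurable D ->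
  measurable_fun D a -> measurable_fun D b ->
  (forall x, D x -> 0 <= a x)%E -> (forall x, D x -> 0 <= b x)%E ->
  (\int[m]_(x in D) (2%:E * a x + 2%:E * b x) =
   2%:E * \int[m]_(x in D) a x + 2%:E * \int[m]_(x in D) b x)%E.
Proof.
move=> mD ma mb a0 b0; rewrite ge0_integralD//.
- by rewrite !ge0_integralZl.
- by move=> x Dx; rewrite mule_ge0// a0.
- exact: measurable_funeM.
- by move=> x Dx; rewrite mule_ge0// b0.
- exact: measurable_funeM.
Qed.

(** The pointwise inequality is f^2 <= 2 (g - f)^2 + 2 g^2. *)
Lemma slab_integral_sqr_le (t : R) (f g : R * T -> R) :
  measurable_fun (`[0, t] `*` [set: T]) f ->
  measurable_fun (`[0, t] `*` [set: T]) g ->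
  (\int[P]_w \int[mu]_(s in `[0%R, t]) (f (s, w) ^+ 2)%:E <=
   2%:E * \int[P]_w \int[mu]_(s in `[0%R, t]) ((g (s, w) - f (s, w)) ^+ 2)%:E +
   2%:E * \int[P]_w \int[mu]_(s in `[0%R, t]) (g (s, w) ^+ 2)%:E)%E.
Proof.
move=> mf mg.
have mslab (h : R * T -> R) : measurable_fun (`[0, t] `*` [set: T]) h ->
    measurable_fun (`[0, t] `*` [set: T]) (fun x => (h x ^+ 2)%:E).
  by move=> mh; apply/measurable_EFinP; exact: measurable_funX.
have m1 := mslab _ mf; have m2 := mslab _ mg.
have m3 := mslab _ (measurable_funB mg mf).
have sq0 (h : R * T -> R) x : (0 <= (h x ^+ 2)%:E)%E by rewrite lee_fin sqr_ge0.
have [M1 _ _] := fubini_tonelli_slab m1 (sq0 _).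
have [M2 _ _] := fubini_tonelli_slab m2 (sq0 _).
have [M3 _ _] := fubini_tonelli_slab m3 (sq0 _).
rewrite -ge0_integral2D//; last 2 first.
- by move=> w _; apply: integral_ge0 => s _; exact: (sq0 (fun x => g x - f x)).
- by move=> w _; apply: integral_ge0 => s _; exact: (sq0 g).
apply: ge0_le_integral => //.
- by move=> w _; apply: integral_ge0 => s _; exact: (sq0 f).
- by apply: emeasurable_funD; exact: measurable_funeM.
move=> w _.
have n1 := slab_measurable_time w m1.
have n2 := slab_measurable_time w m2.
have n3 := slab_measurable_time w m3.
rewrite -ge0_integral2D//; last first.
  by move=> s _; exact: (sq0 (fun x => g x - f x)).
apply: ge0_le_integral => //.
  by apply: emeasurable_funD; exact: measurable_funeM.
move=> s _; rewrite -!EFinM -EFinD lee_fin.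
by have := sqr_ge0 (2 * g (s, w) - f (s, w)); nra.
Qed.

End time_space_integrals.

(** * Passage to the limit in the stochastic integral *)

Section ito_integrals.
Context d (T : measurableType d) (R : realType) (P : probability T R).
Context (F : R -> set (set T)) (W : R -> T -> R).
Hypothesis filtF : is_filtration F.
Hypothesis bmW : brownian_motion P F W.
Local Notation mu := (@lebesgue_measure R).

Lemma cvge0_near_lt (u : nat -> \bar R) (e : R) : 0 < e ->
  u n @[n --> \oo] --> 0%E -> \forall n \near \oo, (u n < e%:E)%E.
Proof.
move=> e0 u0; apply: (u0 [set x | (x < e%:E)%E]).
by apply: open_ereal_lt'; rewrite lte_fin.
Qed.

Lemma sq_dist_lt (X Y : T -> R) (e : R) :
  measurable_fun setT X -> measurable_fun setT Y ->
  (sq_dist P X Y < e%:E)%E ->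
  square_integrable P (fun w => X w - Y w) /\
  \int[P]_w ((X w - Y w) ^+ 2) < e.
Proof.
move=> mX mY XYe; have mXY : measurable_fun setT (fun w => X w - Y w).
  exact: measurable_funB.
have i2 : P.-integrable setT (fun w => ((X w - Y w) ^+ 2)%:E).
  apply/integrableP; split; first by apply/measurable_EFinP; exact: measurable_funX.
  under eq_integral do rewrite gee0_abs ?lee_fin ?sqr_ge0//.
  by rewrite (lt_trans XYe)// ltry.
by split=> //; rewrite -lte_fin EFin_Rintegral.
Qed.

(** This follows from the pointwise bound |x| <= e + x^2 / e. *)
Lemma mean_norm_le (X : T -> R) (e : R) : 0 < e -> square_integrable P X ->
  \int[P]_w (X w ^+ 2) <= e ^+ 2 -> \int[P]_w `|X w| <= 2 * e.
Proof.
move=> e0 sX Xe; have [mX iX] := sX.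
have iX1 := square_integrable_integrable sX.
have ie : P.-integrable setT (EFin \o cst e) by exact: finite_measure_integrable_cst.
have iXe : P.-integrable setT (fun w => (e^-1 * X w ^+ 2)%:E).
  exact: (integrableZl measurableT e^-1 iX).
apply: (@le_trans _ _ (\int[P]_w (cst e w + e^-1 * X w ^+ 2))).
  apply: le_Rintegral => //.
  - exact: integrable_norm.
  - exact: (integrableD measurableT ie iXe).
  move=> w _; rewrite /= -(real_normK (num_real (X w))).
  rewrite -(ler_pM2l e0) mulrDr mulrA divff ?gt_eqF// mul1r.
  by have := sqr_ge0 (`|X w| - e); have := normr_ge0 (X w); nra.
rewrite RintegralD// RintegralZl//.
rewrite Rintegral_cst_probability.
rewrite mulr_natl mulr2n lerD2l -(ler_pM2l e0) mulrA divff ?gt_eqF// mul1r.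
by rewrite -expr2.
Qed.

Variables H I : R -> T -> R.
Hypothesis itoI : is_ito_integral P F W H I.

Lemma ito_integral_measurable t : 0 <= t -> measurable_fun setT (I t).
Proof.
by move=> t0; apply: (filtration_measurable filtF t0); case: itoI => _ + _ _; exact.
Qed.

Lemma ito_integral_square_integrable t : 0 <= t -> square_integrable P (I t).
Proof.
move=> t0; have mI := ito_integral_measurable t0.
case: itoI => _ _ _ [S [predS _ /(_ _ t0)/(cvge0_near_lt ltr01)[n _ /(_ n (leqnn n))]]].
have sJ := simple_integral_square_integrable filtF bmW (predS n) t0.
have [mJ _] := sJ => /(sq_dist_lt mJ mI)[sJI _].
have sN : square_integrable P (fun w => - (simple_integral W (S n) t w - I t w)).
  case: sJI => mJI iJI; split; first exact: measurable_funN.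
  by apply: eq_integrable iJI => // w _; rewrite sqrrN.
have := square_integrableD sJ sN.
by under [X in square_integrable P X -> _]eq_fun do rewrite /= opprB addrC subrK.
Qed.

(** The corresponding integrals of the simple approximations vanish, and a
    multiplier bounded by 1 does not amplify their L^1 distance to I. *)
Lemma ito_integral_martingale s t (Y : T -> R) : 0 <= s -> s <= t ->
  measurable_wrt (F s) Y -> (forall w, `|Y w| <= 1) ->
  \int[P]_w (Y w * (I t w - I s w)) = 0.
Proof.
move=> s0 st mY Y1; have t0 := le_trans s0 st.
have mIt := ito_integral_measurable t0; have mIs := ito_integral_measurable s0.
have mYT := filtration_measurable filtF s0 mY.
suff small e : 0 < e -> `|\int[P]_w (Y w * (I t w - I s w))| <= 4 * e.
  apply/eqP; rewrite -normr_eq0; apply/eqP/le_anti; rewrite normr_ge0 andbT.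
  apply/ler_addgt0Pr => e e0; rewrite add0r.
  by have := small (e / 4); rewrite divr_gt0// => /(_ isT); rewrite mulrCA divff// mulr1.
move=> e0; have ee0 : 0 < e ^+ 2 by rewrite exprn_gt0.
case: itoI => _ _ _ [S [predS _ cvJ]].
have [n [Jt Js]] : exists n,
    (sq_dist P (simple_integral W (S n) t) (I t) < (e ^+ 2)%:E)%E /\
    (sq_dist P (simple_integral W (S n) s) (I s) < (e ^+ 2)%:E)%E.
  have /filterI/(_ (cvge0_near_lt ee0 (cvJ s s0))) := cvge0_near_lt ee0 (cvJ t t0).
  by move=> [n _ /(_ n (leqnn n)) []]; exists n.
set J := simple_integral W (S n) in Jt Js *.
have [mJt _] := simple_integral_square_integrable filtF bmW (predS n) t0.
have [mJs _] := simple_integral_square_integrable filtF bmW (predS n) s0.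
have [sa /ltW ae] := sq_dist_lt mJt mIt Jt.
have [sb /ltW be] := sq_dist_lt mJs mIs Js.
have ia := square_integrable_integrable sa.
have ib := square_integrable_integrable sb.
have [iJ J0] := simple_integral_martingale filtF bmW (predS n) s0 st mY Y1.
pose D w := Y w * ((J t w - I t w) - (J s w - I s w)).
have mD : measurable_fun setT D.
  by apply: measurable_funM => //; apply: measurable_funB; [case: sa|case: sb].
have iab : P.-integrable setT (EFin \o (fun w => `|J t w - I t w| + `|J s w - I s w|)).
  exact: (integrableD measurableT (integrable_norm ia) (integrable_norm ib)).
have D_le w : `|D w| <= `|J t w - I t w| + `|J s w - I s w|.
  rewrite /D normrM (le_trans _ (ler_normB _ _))//.
  by rewrite -[leRHS]mul1r ler_wpM2r.
have iD := dominated_integrable mD D_le iab.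
rewrite (_ : \int[P]_w (Y w * (I t w - I s w)) = - \int[P]_w D w); last first.
  transitivity (\int[P]_w (Y w * (J t w - J s w) - D w)).
    by apply: eq_Rintegral => w _; rewrite /D; ring.
  by rewrite RintegralB// J0 sub0r.
rewrite normrN (le_trans (le_normr_Rintegral measurableT iD))//.
apply: (@le_trans _ _ (\int[P]_w (`|J t w - I t w| + `|J s w - I s w|))).
  by apply: le_Rintegral => //; exact: integrable_norm.
rewrite RintegralD//; [|exact: integrable_norm|exact: integrable_norm].
have := mean_norm_le e0 sa ae; have := mean_norm_le e0 sb be; lra.
Qed.

(** One approximating simple process at distance less than 1, both in integrand
    and in integral, is enough: its energy is at most E J^2 / k with
    E J^2 <= 2 + 2 c, and the inequality f^2 <= 2 (g - f)^2 + 2 g^2 transfers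
    the bound to H. *)
Lemma ito_integral_energy (k c t : R) : 0 < k ->
  (forall s, 0 < s ->
    ((k * s ^+ 2)%:E <= \int[normal_prob 0 s]_x (x ^+ 2)%:E)%E) ->
  0 <= t -> \int[P]_w (I t w ^+ 2) <= c ->
  (\int[P]_w \int[mu]_(s in `[0%R, t]) (H s w ^+ 2)%:E <=
   (2 + (4 + 4 * c) / k)%:E)%E.
Proof.
move=> k0 kP t0 Ic; have mI := ito_integral_measurable t0.
case: (itoI) => pH _ _ [S [predS cvS cvJ]].
have [n [Sn Jn]] : exists n,
    (sq_dist_upto P t (simple_eval (S n)) H < 1%:E)%E /\
    (sq_dist P (simple_integral W (S n) t) (I t) < 1%:E)%E.
  have /filterI/(_ (cvge0_near_lt ltr01 (cvJ t t0))) := cvge0_near_lt ltr01 (cvS t t0).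
  by move=> [n _ /(_ n (leqnn n)) []]; exists n.
have sJ := simple_integral_square_integrable filtF bmW (predS n) t0.
have sI := ito_integral_square_integrable t0.
have [mJ iJ] := sJ; have [_ iI] := sI.
have [sJI JI1] := sq_dist_lt mJ mI Jn; have [_ iJI] := sJI.
set J := simple_integral W (S n) t in mJ iJ sJ JI1 iJI sJI.
have J_le : \int[P]_w (J w ^+ 2) <= 2 + 2 * c.
  apply: (@le_trans _ _ (\int[P]_w (2 * (J w - I t w) ^+ 2 + 2 * I t w ^+ 2))).
    have i1 := integrableZl measurableT 2 iJI.
    have i2 := integrableZl measurableT 2 iI.
    apply: le_Rintegral => //; first exact: (integrableD measurableT i1 i2).
    by move=> w _ /=; have := sqr_ge0 (2 * I t w - J w); nra.
  rewrite RintegralD ?RintegralZl//; last 2 first.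
    exact: (integrableZl measurableT 2 iJI).
    exact: (integrableZl measurableT 2 iI).
  by move: JI1 Ic; lra.
have := simple_integral_energy filtF bmW (predS n) kP t0.
rewrite -/J -EFin_Rintegral// => /le_trans/(_ (_ : _ <= (2 + 2 * c)%:E)%E).
rewrite lee_fin => /(_ J_le) SE.
have mS : measurable_fun (`[0, t] `*` [set: T]) (fun x : R * T => simple_eval (S n) x.1 x.2).
  by apply: measurable_funTS; exact: (simple_eval_measurable filtF (predS n)).
have mH := progressive_measurable filtF t0 pH.
apply: (le_trans (slab_integral_sqr_le P mH mS)).
rewrite (EFinD 2 ((4 + 4 * c) / k)) leeD//.
  by rewrite -[leRHS]mule1 lee_pmul2l// ltW.
rewrite (_ : (4 + 4 * c) / k = 2 * (k^-1 * (2 + 2 * c))); last by field; rewrite gt_eqF.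
rewrite EFinM lee_pmul2l// -(@lee_pmul2l _ k%:E)// -EFinM.
by rewrite mulrA divff ?gt_eqF// mul1r.
Qed.

End ito_integrals.

(** * Events with summable changes *)

Section limsup_of_events.
Context d (T : measurableType d) (R : realType) (P : probability T R).
Variable A : (set T)^nat.
Hypothesis mA : forall n, measurable (A n).

Lemma measurable_lim_sup_set : measurable (lim_sup_set A).
Proof.
by apply: bigcapT_measurable => n; apply: bigcup_measurable => k _.
Qed.

Lemma measurable_setY (B C : set T) : measurable B -> measurable C ->
  measurable (B `+` C).
Proof. by move=> mB mC; apply: measurableU; exact: measurableD. Qed.

Lemma indic_setY (B C : set T) w :
  \1_(B `+` C) w = (\1_B w - \1_C w) ^+ 2 :> R.
Proof.
rewrite !indicE in_setU !in_setD.
by case: (w \in B); case: (w \in C); rewrite /= ?subrr ?subr0 ?sub0r ?sqrrN ?expr1n ?expr0n.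
Qed.

(** A point whose membership never changes from rank n on belongs to the limit
    superior exactly when it belongs to the n-th event. *)
Lemma lim_sup_set_setY n :
  A n `+` lim_sup_set A `<=` \bigcup_i (A (n + i)%N `+` A (n + i).+1).
Proof.
move=> w; apply: contraPP => noswitch.
have same i : A (n + i)%N w <-> A n w.
  elim: i => [|i IH]; first by rewrite addn0.
  rewrite -IH addnS; split => Aw; apply: contrapT => nAw; apply: noswitch;
    exists i => //; by [right|left].
move=> [[An nlim]|[lim nAn]].
  by apply: nlim => m _; exists (n + m)%N; [exact: leq_addl|exact/same].
by have [m /= nm Am] := lim n I; apply/nAn/(same (m - n)%N); rewrite subnKC.
Qed.

Lemma lim_sup_set_setY_le (c : R) : 0 <= c ->
  (forall m, (P (A m `+` A m.+1) <= (c / 2 ^+ m)%:E)%E) ->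
  forall n, (P (A n `+` lim_sup_set A) <= (2 * c / 2 ^+ n)%:E)%E.
Proof.
move=> c0 Ac n; have mY m : measurable (A m `+` A m.+1) by exact: measurable_setY.
apply: (le_trans (measure_sigma_subadditive P _ _ (@lim_sup_set_setY n))) => //.
  by apply: measurable_setY => //; exact: measurable_lim_sup_set.
apply: le_trans (epsilon_trick0 xpredT (_ : 0 <= 2 * c / 2 ^+ n)); last first.
  by rewrite divr_ge0 ?exprn_ge0// mulr_ge0.
apply: lee_nneseries => // i _; apply: (le_trans (Ac _)).
rewrite lee_fin natrX exprD exprS le_eqVlt; apply/orP; left; apply/eqP.
by field; rewrite !expf_neq0.
Qed.

End limsup_of_events.

(** * Martingales with values in the unit interval *)

Section unit_interval_martingale.
Context d (T : measurableType d) (R : realType) (P : probability T R).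
Context (F : R -> set (set T)) (X : R -> T -> R).
Hypothesis filtF : is_filtration F.
Hypothesis adaptedX : adapted F X.
Hypothesis X01 : forall t w, 0 <= t -> 0 <= X t w <= 1.
Hypothesis martX : forall s t (Y : T -> R), 0 <= s -> s <= t ->
  measurable_wrt (F s) Y -> (forall w, `|Y w| <= 1) ->
  \int[P]_w (Y w * (X t w - X s w)) = 0.

Let mX t : 0 <= t -> measurable_fun setT (X t).
Proof. by move=> t0; exact: (filtration_measurable filtF t0 (adaptedX t0)). Qed.

Let X_norm t w : 0 <= t -> `|X t w| <= 1.
Proof. by move=> t0; have /andP[? ?] := X01 w t0; rewrite ger0_norm. Qed.

(** For a variable with values in [0, 1] this vanishes exactly when the variable
    takes almost surely the values 0 and 1 only. *)
Definition spread t : R := \int[P]_w (X t w * (1 - X t w)).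

Lemma spread_integrable t : 0 <= t ->
  P.-integrable setT (fun w => (X t w * (1 - X t w))%:E).
Proof.
move=> t0; apply: (@bounded_integrable _ _ _ _ 1).
  by apply: measurable_funM; [exact: mX|apply: measurable_funB => //; exact: mX].
move=> w; have /andP[x0 x1] := X01 w t0.
rewrite ger0_norm; first by rewrite mulr_ile1 ?subr_ge0// lerBlDr lerDl.
by rewrite mulr_ge0// subr_ge0.
Qed.

(** The square of X_t - X_s equals X_s (1 - X_s) - X_t (1 - X_t) up to multiples of
    X_t - X_s by variables known at time s, whose expectation vanishes. *)
Lemma increment_sqr_spread s t : 0 <= s -> s <= t ->
  \int[P]_w ((X t w - X s w) ^+ 2) = spread s - spread t.
Proof.
move=> s0 st; have t0 := le_trans s0 st; have ms := mX s0; have mt := mX t0.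
have m1 : measurable_wrt (F s) (cst 1 : T -> R) by exact: measurable_cst.
have i1 : P.-integrable setT (fun w => (cst 1 w * (X t w - X s w))%:E).
  apply: (@bounded_integrable _ _ _ _ 2).
    by apply: measurable_funM => //; exact: measurable_funB.
  move=> w; rewrite mul1r; have /andP[? ?] := X01 w t0; have /andP[? ?] := X01 w s0.
  by rewrite ler_norml; lra.
have i2 : P.-integrable setT (fun w => (2 * (X s w * (X t w - X s w)))%:E).
  apply: (@bounded_integrable _ _ _ _ 4).
    by apply: measurable_funM => //; apply: measurable_funM => //; exact: measurable_funB.
  move=> w; have /andP[? ?] := X01 w t0; have /andP[? ?] := X01 w s0.
  by rewrite ler_norml; nra.
have is_ := spread_integrable s0; have it_ := spread_integrable t0.
transitivity (\int[P]_w (X s w * (1 - X s w) - X t w * (1 - X t w) +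
    (cst 1 w * (X t w - X s w) - 2 * (X s w * (X t w - X s w))))).
  by apply: eq_Rintegral => w _ /=; ring.
rewrite RintegralD//; last 2 first.
- exact: (integrableB measurableT is_ it_).
- exact: (integrableB measurableT i1 i2).
rewrite RintegralB// RintegralB// martX//; last by move=> w; rewrite normr1.
rewrite RintegralZl//; last first.
  apply: (@bounded_integrable _ _ _ _ 2).
    by apply: measurable_funM => //; exact: measurable_funB.
  move=> w; have /andP[? ?] := X01 w t0; have /andP[? ?] := X01 w s0.
  by rewrite ler_norml; nra.
rewrite martX//; first by rewrite mulr0 subr0 addr0.
- exact: adaptedX.
- by move=> w; exact: X_norm.
Qed.

Lemma spread_nonincreasing s t : 0 <= s -> s <= t -> spread t <= spread s.
Proof.
move=> s0 st; rewrite -subr_ge0 -increment_sqr_spread//.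
by apply: Rintegral_ge0 => w _; exact: sqr_ge0.
Qed.

Hypothesis spread_small : forall e, 0 < e -> exists2 t, 0 <= t & spread t <= e.

(** Summing arbitrary times of small spread makes them increase to infinity; the
    spread only becomes smaller. *)
Lemma fast_times : exists t : nat -> R, [/\ forall n, n%:R <= t n,
  forall n, t n <= t n.+1 & forall n, spread (t n) <= (2 ^+ n)^-1].
Proof.
have /choice[u u_] : forall n : nat, exists t, 0 <= t /\ spread t <= (2 ^+ n)^-1.
  move=> n; have e0 : 0 < (2 ^+ n)^-1 :> R by rewrite invr_gt0 exprn_gt0.
  by have [t t0 te] := spread_small e0; exists t.
(* The summand 1 forces t n to grow at least like n. *)
pose t n := \sum_(i < n.+1) (u i + 1).
have S0 n : 0 <= \sum_(i < n) (u i + 1).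
  by apply: sumr_ge0 => i _; rewrite addr_ge0//; have [] := u_ i.
have le_t n : n.+1%:R <= t n.
  rewrite /t (le_trans _ (ler_sum _ (F := fun=> 1) _))//.
    by rewrite sumr_const card_ord.
  by move=> i _; rewrite lerDr; have [] := u_ i.
exists t; split=> n.
- by rewrite (le_trans _ (le_t n))// ler_nat.
- by rewrite /t [leRHS]big_ord_recr/= lerDl addr_ge0//; have [] := u_ n.+1.
have [un0 une] := u_ n; apply: le_trans une.
apply: spread_nonincreasing => //.
by rewrite /t big_ord_recr/= addrA -lerBlDr; have := S0 n; lra.
Qed.

Definition high t := [set w | 2^-1 < X t w].

Lemma high_measurable t : 0 <= t -> measurable (high t).
Proof.
move=> t0; have := mX t0 measurableT (measurable_itv `]2^-1, +oo[).
rewrite setTI; congr measurable.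
by apply/seteqP; split => w /=; rewrite /high/= in_itv/= andbT.
Qed.

Lemma indic_high t w : \1_(high t) w = (2^-1 < X t w)%R%:R :> R.
Proof. by rewrite indicE; congr (nat_of_bool _)%:R; apply/idP/idP; rewrite inE. Qed.

(** Where exactly one of X_s and X_t exceeds 1/2, one of the three quantities
    X_s (1 - X_s), (X_t - X_s)^2 and X_t (1 - X_t) is bounded below: for x in
    [0, 1] the squared distance from x to the nearest of 0 and 1 is at most
    x (1 - x), and (a + b + c)^2 <= 3 (a^2 + b^2 + c^2). *)
Lemma high_setY_le s t : 0 <= s -> s <= t ->
  (P (high s `+` high t) <= (6 * spread s)%:E)%E.
Proof.
move=> s0 st; have t0 := le_trans s0 st; have ms := mX s0; have mt := mX t0.
have mC := measurable_setY (high_measurable s0) (high_measurable t0).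
rewrite probability_Rintegral// lee_fin.
have is_ := spread_integrable s0; have it_ := spread_integrable t0.
have i2 : P.-integrable setT (fun w => ((X t w - X s w) ^+ 2)%:E).
  apply: (@bounded_integrable _ _ _ _ 1).
    by apply: measurable_funX; exact: measurable_funB.
  move=> w; have /andP[? ?] := X01 w t0; have /andP[? ?] := X01 w s0.
  by rewrite ler_norml; nra.
have i3 := integrableD measurableT (integrableD measurableT is_ i2) it_.
apply: (@le_trans _ _ (\int[P]_w (3 * (X s w * (1 - X s w) + (X t w - X s w) ^+ 2 +
    X t w * (1 - X t w))))); last first.
  rewrite RintegralZl// RintegralD//; last exact: (integrableD measurableT is_ i2).
  rewrite RintegralD// increment_sqr_spread// -/(spread s) -/(spread t).
  by rewrite le_eqVlt; apply/orP; left; apply/eqP; ring.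
apply: le_Rintegral => //.
- exact: indic_integrable.
- exact: (integrableZl measurableT 3 i3).
move=> w _; rewrite indic_setY !indic_high.
have /andP[? ?] := X01 w t0; have /andP[? ?] := X01 w s0.
by case: ltP => ?; case: ltP => ? /=; nra.
Qed.

(** For x in [0, 1] the distance from x to the nearest of 0 and 1 is at most
    2 x (1 - x). *)
Lemma high_gap t w (G B : set T) : 0 <= t ->
  `|\1_G w * (X t w - \1_B w)| <=
  2 * (X t w * (1 - X t w)) + \1_(high t `+` B) w.
Proof.
move=> t0; have /andP[? ?] := X01 w t0.
rewrite normrM (@le_trans _ _ `|X t w - \1_B w|)//.
  by rewrite ler_piMl// normr_indic_le1.
rewrite indic_setY indic_high indicE ler_norml.
by case: ltP => ?; case: (_ \in _) => /=; apply/andP; split; nra.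
Qed.

(** Testing against an event G known at time s, the martingale property allows
    X_s to be replaced by X_(t_n), which differs from the indicator of B by at
    most 14 / 2^n in mean: 2 / 2^n for the distance to the indicator of the n-th
    event, and 12 / 2^n for the distance of that event to B. *)
Lemma unit_interval_martingale_limit : exists2 B : set T, measurable B &
  forall t (G : set T), 0 <= t -> F t G ->
    \int[P]_w (\1_G w * X t w) = \int[P]_w (\1_G w * \1_B w).
Proof.
have [t [t_ge t_nd t_spread]] := fast_times.
have t0 n : 0 <= t n by rewrite (le_trans _ (t_ge n)).
pose A n := high (t n).
have mA n : measurable (A n) by exact: high_measurable.
pose B := lim_sup_set A; have mB : measurable B := measurable_lim_sup_set mA.
have AB n : (P (A n `+` B) <= (2 * 6 / 2 ^+ n)%:E)%E.
  apply: lim_sup_set_setY_le => // m; apply: (le_trans (high_setY_le (t0 m) (t_nd m))).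
  by rewrite lee_fin ler_wpM2l.
exists B => // s G s0 FG.
have mGs : measurable_wrt (F s) (\1_G : T -> R) by exact: measurable_wrt_indic.
have mG : measurable_fun setT (\1_G : T -> R) by exact: (filtration_measurable filtF s0).
have mB1 : measurable_fun setT (\1_B : T -> R) by exact: measurable_indic.
have G1 := @normr_indic_le1 _ _ R G.
have B1 := @normr_indic_le1 _ _ R B.
have iGX r : 0 <= r -> P.-integrable setT (fun w => (\1_G w * X r w)%:E).
  move=> r0; apply: (@bounded_integrable _ _ _ _ 1).
    by apply: measurable_funM => //; exact: mX.
  by move=> w; rewrite normrM mulr_ile1// X_norm.
have iGB : P.-integrable setT (fun w => (\1_G w * \1_B w)%:E).
  apply: (@bounded_integrable _ _ _ _ 1); first exact: measurable_funM.
  by move=> w; rewrite normrM mulr_ile1.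
have close n : s <= t n ->
    `|\int[P]_w (\1_G w * X s w) - \int[P]_w (\1_G w * \1_B w)| <= 14 / 2 ^+ n.
  move=> stn.
  have -> : \int[P]_w (\1_G w * X s w) = \int[P]_w (\1_G w * X (t n) w).
    apply/esym/eqP; rewrite -subr_eq0 -RintegralB//; try exact: iGX.
    rewrite -[eqbRHS](martX s0 stn mGs G1); apply/eqP.
    by apply: eq_Rintegral => w _; rewrite mulrBr.
  have -> : \int[P]_w (\1_G w * X (t n) w) - \int[P]_w (\1_G w * \1_B w) =
      \int[P]_w (\1_G w * (X (t n) w - \1_B w)).
    rewrite -RintegralB//; last exact: iGX.
    by apply: eq_Rintegral => w _; rewrite mulrBr.
  have mAB : measurable (A n `+` B) by exact: measurable_setY.
  have i1 : P.-integrable setT (fun w => (2 * (X (t n) w * (1 - X (t n) w)))%:E).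
    exact: (integrableZl measurableT 2 (spread_integrable (t0 n))).
  have i2 : P.-integrable setT (EFin \o (\1_(A n `+` B) : T -> R)).
    exact: indic_integrable.
  have mD : measurable_fun setT (fun w => \1_G w * (X (t n) w - \1_B w)).
    by apply: measurable_funM => //; apply: measurable_funB => //; exact: mX.
  have i3 := integrableD measurableT i1 i2.
  have iD := dominated_integrable mD (fun w => high_gap w G B (t0 n)) i3.
  rewrite (le_trans (le_normr_Rintegral measurableT iD))//.
  apply: (@le_trans _ _ (\int[P]_w (2 * (X (t n) w * (1 - X (t n) w)) + \1_(A n `+` B) w))).
    apply: le_Rintegral => //; first exact: integrable_norm.
    by move=> w _; exact: high_gap.
  rewrite RintegralD// RintegralZl//; last exact: spread_integrable.
  have := AB n; rewrite probability_Rintegral// lee_fin.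
  by have := t_spread n; rewrite /spread; set e := (2 ^+ n)^-1; lra.
apply/eqP; rewrite -subr_eq0 -normr_eq0; apply/eqP/le_anti; rewrite normr_ge0 andbT.
apply/ler_addgt0Pr => e e0; rewrite add0r.
pose n := (Num.trunc s + Num.trunc (14 / e)).+1.
have ns : s < n%:R.
  by rewrite (lt_le_trans (truncnS_gt _))// ler_nat ltnS leq_addr.
have ne : 14 / e < n%:R.
  by rewrite (lt_le_trans (truncnS_gt _))// ler_nat ltnS leq_addl.
apply: (le_trans (close n (le_trans (ltW ns) (t_ge n)))).
rewrite ler_pdivrMr ?exprn_gt0// -ler_pdivrMl// mulrC (le_trans (ltW ne))//.
by rewrite -natrX ler_nat ltnW// ltn_expl.
Qed.

End unit_interval_martingale.

(** * Diffusions that vanish only at the ends of the unit interval *)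

Section vanishing_diffusion.
Context (R : realType) (sigma : R -> R).
Hypothesis sigma_cont : {within `[0, 1], continuous sigma}.
Hypothesis sigma_gt0 : forall x, 0 < x < 1 -> 0 < sigma x.

(** Outside [e, 1 - e] the left-hand side is already at most e; inside, sigma
    has a positive minimum, attained at c, and C = 1 / sigma(c)^2 works. *)
Lemma diffusion_controls_spread (e : R) : 0 < e -> exists2 C, 0 < C &
  forall x, 0 <= x <= 1 -> x * (1 - x) <= e + C * sigma x ^+ 2.
Proof.
move=> e0; have [e12|e12] := leP e (1 - e); last first.
  exists 1 => // x /andP[x0 x1]; rewrite mul1r.
  by have := sqr_ge0 (2 * x - 1); have := sqr_ge0 (sigma x); nra.
have sub : `[e, 1 - e] `<=` `[0, 1].
  move=> x /=; rewrite !in_itv/= => /andP[ex xe].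
  by rewrite (le_trans (ltW e0) ex) (le_trans xe)// lerBlDr lerDl ltW.
have [c + cmin] := EVT_min e12 (continuous_subspaceW sub sigma_cont).
rewrite in_itv/= => /andP[ec ce].
have sc0 : 0 < sigma c.
  by apply: sigma_gt0; rewrite (lt_le_trans e0)// (le_lt_trans ce)// ltrBlDr ltrDl.
exists (sigma c ^+ 2)^-1; first by rewrite invr_gt0 exprn_gt0.
move=> x /andP[x0 x1].
have s2 : 0 <= (sigma c ^+ 2)^-1 * sigma x ^+ 2.
  by rewrite mulr_ge0// ?invr_ge0 sqr_ge0.
have [xe|ex] := ltP x e; first by nra.
have [ex'|xe'] := ltP (1 - e) x; first by nra.
have cx : sigma c <= sigma x by apply: cmin; rewrite in_itv/= ex xe'.
have : 1 <= (sigma c ^+ 2)^-1 * sigma x ^+ 2.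
  rewrite mulrC ler_pdivlMr ?exprn_gt0// mul1r ler_pXn2r// nnegrE ltW//.
  exact: lt_le_trans cx.
by have := sqr_ge0 (2 * x - 1); nra.
Qed.

End vanishing_diffusion.

Section diffusion_in_unit_interval.
Context d (T : measurableType d) (R : realType) (P : probability T R).
Context (F : R -> set (set T)) (W : R -> T -> R).
Context (sigma : R -> R) (Z : R -> T -> R) (H I : R -> T -> R).
Hypothesis filtF : is_filtration F.
Hypothesis bmW : brownian_motion P F W.
Hypothesis sigma_cont : {within `[0, 1], continuous sigma}.
Hypothesis sigma_gt0 : forall x, 0 < x < 1 -> 0 < sigma x.
Hypothesis adaptedZ : adapted F Z.
Hypothesis Z01 : forall t w, 0 <= t -> 0 <= Z t w <= 1.
Hypothesis HZ : {ae P, forall w, forall t, 0 <= t -> H t w = sigma (Z t w)}.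
Hypothesis itoI : is_ito_integral P F W H I.
Hypothesis ZI : {ae P, forall w, forall t, 0 <= t -> Z t w = Z 0 w + I t w}.

Let mZ t : 0 <= t -> measurable_fun setT (Z t).
Proof. by move=> t0; exact: (filtration_measurable filtF t0 (adaptedZ t0)). Qed.

Let mI t : 0 <= t -> measurable_fun setT (I t).
Proof. exact: (ito_integral_measurable filtF itoI). Qed.

Lemma diffusion_continuous : {ae P, forall w, continuous_path Z w}.
Proof.
apply: filterS ZI => w Zw; case: itoI => _ _ cI _.
apply: (@subspace_eq_continuous _ _ _ (fun t => Z 0 w + I t w)).
  by move=> t; rewrite inE/= in_itv/= andbT => t0; exact/esym/Zw.
by move=> t; apply: cvgD; [exact: cvg_cst|exact: cI].
Qed.

Lemma diffusion_martingale s t (Y : T -> R) : 0 <= s -> s <= t ->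
  measurable_wrt (F s) Y -> (forall w, `|Y w| <= 1) ->
  \int[P]_w (Y w * (Z t w - Z s w)) = 0.
Proof.
move=> s0 st mY Y1; have t0 := le_trans s0 st.
have mYT := filtration_measurable filtF s0 mY.
rewrite -[RHS](ito_integral_martingale filtF bmW itoI s0 st mY Y1).
apply: ae_eq_Rintegral.
- by apply: measurable_funM => //; apply: measurable_funB; exact: mZ.
- by apply: measurable_funM => //; apply: measurable_funB; exact: mI.
by apply: filterS ZI => w Zw; rewrite (Zw t t0) (Zw s s0); congr *%R; ring.
Qed.

Lemma ito_integral_second_moment t : 0 <= t -> \int[P]_w (I t w ^+ 2) <= 1.
Proof.
move=> t0; rewrite (@ae_eq_Rintegral _ _ _ P _ (fun w => (Z t w - Z 0 w) ^+ 2)); last 3 first.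
- by apply: measurable_funX; exact: mI.
- by apply: measurable_funX; apply: measurable_funB; exact: mZ.
- by apply: filterS ZI => w /(_ t t0) ->; rewrite addrAC subrr add0r.
rewrite -[leRHS](Rintegral_cst_probability P).
have b w : `|(Z t w - Z 0 w) ^+ 2| <= 1.
  by have /andP[? ?] := Z01 w t0; have /andP[? ?] := Z01 w (lexx 0); rewrite ler_norml; nra.
apply: le_Rintegral => //.
- apply: (@bounded_integrable _ _ _ P 1 (fun w => (Z t w - Z 0 w) ^+ 2) _ b).
  by apply: measurable_funX; apply: measurable_funB; exact: mZ.
- exact: finite_measure_integrable_cst.
by move=> w _; exact: le_trans (ler_norm _) (b w).
Qed.

(** If the spread were above e at time t, it would be so at all earlier times s;
    then the second moment of H_s would be at least e / (2 C) there, and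
    integrating over [0, t] would give the energy K + 1, one more than the bound
    K allows.  This is what fixes the value of t. *)
Lemma diffusion_spread_small e : 0 < e ->
  exists2 t, 0 <= t & spread P Z t <= e.
Proof.
move=> e0; have e20 : 0 < e / 2 by rewrite divr_gt0.
have [C C0 CP] := diffusion_controls_spread sigma_cont sigma_gt0 e20.
have [k k0 kP] := @normal_second_moment_ge R.
pose K : R := 2 + (4 + 4 * 1) / k.
have K0 : 0 <= K by rewrite /K addr_ge0// divr_ge0// ltW.
pose t : R := 2 * C * (K + 1) / e.
have K1 : 0 < K + 1 by rewrite ltr_wpDl.
have tgt0 : 0 < t by rewrite divr_gt0// mulr_gt0// mulr_gt0.
have t0 := ltW tgt0.
exists t => //; rewrite leNgt; apply/negP => et.
case: (itoI) => pH _ _ _; have mH := progressive_measurable filtF t0 pH.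
have mH2 : measurable_fun (`[0, t] `*` [set: T]) (fun x : R * T => (H x.1 x.2 ^+ 2)%:E).
  by apply/measurable_EFinP; exact: measurable_funX.
have H2_ge0 (x : R * T) : (0 <= (H x.1 x.2 ^+ 2)%:E)%E by rewrite lee_fin sqr_ge0.
have [_ mPH swap] := fubini_tonelli_slab P mH2 H2_ge0.
have H2_large s : s \in `[0, t] ->
    ((e / (2 * C))%:E <= \int[P]_w (H s w ^+ 2)%:E)%E.
  move=> st; have mHs := section_measurable mH2 st.
  move: (st); rewrite in_itv/= => /andP[s0 s_le_t].
  have es : e < spread P Z s.
    apply: (lt_le_trans et).
    exact: (spread_nonincreasing filtF adaptedZ Z01 diffusion_martingale).
  have int_le : ((spread P Z s)%:E <=
      (e / 2)%:E + C%:E * \int[P]_w (H s w ^+ 2)%:E)%E.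
    rewrite /spread EFin_Rintegral; last first.
      exact: (spread_integrable P filtF adaptedZ Z01 s0).
    have -> : ((e / 2)%:E = \int[P]_w (e / 2)%:E)%E.
      rewrite integral_cst// [X in (_ * X)%E](_ : _ = 1%E) ?mule1//.
      exact: probability_setT.
    rewrite -ge0_integralZl//; last 2 first.
    - by move=> w _; exact: (H2_ge0 (s, w)).
    - by rewrite lee_fin ltW.
    rewrite -ge0_integralD//; last 3 first.
    - by move=> w _; rewrite lee_fin ltW.
    - by move=> w _; rewrite -EFinM lee_fin mulr_ge0 ?sqr_ge0// ltW.
    - exact: measurable_funeM.
    apply: ae_ge0_le_integral => //.
    - move=> w _; have /andP[? ?] := Z01 w s0.
      by rewrite lee_fin mulr_ge0// subr_ge0.
    - apply/measurable_EFinP/measurable_funM; first exact: mZ.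
      by apply: measurable_funB => //; exact: mZ.
    - by move=> w _; rewrite -EFinM -EFinD lee_fin addr_ge0 ?(ltW e20)// mulr_ge0 ?sqr_ge0// ltW.
    - by apply: emeasurable_funD => //; exact: measurable_funeM.
    apply: filterS HZ => w /(_ s s0) -> _.
    by rewrite -EFinM -EFinD lee_fin; exact/CP/Z01.
  move: int_le; case: (\int[P]_w (H s w ^+ 2)%:E)%E => [h| |].
  - rewrite -EFinM -EFinD !lee_fin => int_le.
    by rewrite ler_pdivrMr ?mulr_gt0//; lra.
  - by rewrite leey.
  - by rewrite mulrNy gtr0_sg// mul1e.
have := ito_integral_energy filtF bmW itoI k0 kP t0 (ito_integral_second_moment t0).
rewrite -/K leNgt => /negP; apply.
rewrite (swap : _ = _); apply: (@lt_le_trans _ _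
  (\int[lebesgue_measure]_(s in `[0%R, t]) (e / (2 * C))%:E)%E).
  rewrite integral_cst//= lebesgue_measure_itv/= lte_fin.
  rewrite tgt0 oppr0 adde0 -EFinM lte_fin.
  have -> : e / (2 * C) * t = K + 1.
    by rewrite /t; field; rewrite !gt_eqF.
  by rewrite ltrDl.
apply: ge0_le_integral => //.
by move=> s _; rewrite lee_fin divr_ge0 ?(ltW e0)// mulr_ge0// ltW.
Qed.

End diffusion_in_unit_interval.

Theorem theorem2 (d : measure_display) (T : measurableType d) (R : realType)
  (P : probability T R) (F : R -> set (set T))
  (usualF : usual_conditions P F)
  (F_infty : d.-measurable = sigma_infty F)
  (W : R -> T -> R) (bmW : brownian_motion P F W)
  (sigma : R -> R)
  (sigma_ge0 : forall x, 0 <= x <= 1 -> 0 <= sigma x)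
  (sigma_cont : {within `[0, 1], continuous sigma})
  (sigma_gt0 : forall x, 0 < x < 1 -> 0 < sigma x)
  (sigma0 : sigma 0 = 0) (sigma1 : sigma 1 = 0)
  (z : R) (z01 : 0 <= z <= 1)
  (Z : R -> T -> R) (adaptedZ : adapted F Z)
  (Z01 : forall t w, 0 <= t -> 0 <= Z t w <= 1)
  (sdeZ : solves_sde P F W sigma z Z) :
  {ae P, forall w, continuous_path Z w} /\
  exists B : {RV P >-> bool},
    (forall A : set bool, distribution P B A = bernoulli_prob z A) /\
    (forall t, 0 <= t -> is_cond_exp P (F t) (fun w => (B w)%:R) (Z t)).
Proof.
case: usualF => filtF _ _; case: sdeZ => Z0z [H [I [HZ itoI ZI]]].
split; first exact: diffusion_continuous itoI ZI.
have mart := diffusion_martingale filtF bmW adaptedZ itoI ZI.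
have small := diffusion_spread_small filtF bmW sigma_cont sigma_gt0 adaptedZ Z01 HZ itoI ZI.
have [B mB BZ] := unit_interval_martingale_limit filtF adaptedZ Z01 mart small.
have FT t : 0 <= t -> F t setT.
  by case: filtF => /(_ t) + _ t0 => /(_ t0) [F0 FC _]; rewrite -(setD0 setT); exact: FC.
have mZ t : 0 <= t -> measurable_fun setT (Z t).
  by move=> t0; exact: (filtration_measurable filtF t0 (adaptedZ t t0)).
pose b w : bool := w \in B.
have preB : b @^-1` [set true] = B.
  by apply/seteqP; split => w /=; [exact: set_mem|exact: mem_set].
have mb : measurable_fun setT b.
  apply: (@measurable_fun_bool _ _ _ _ true); rewrite setTI.
  by rewrite preB.
pose b' : {RV P >-> bool} := HB.pack b (isMeasurableFun.Build _ _ _ _ b mb).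
have bE w : (b' w)%:R = \1_B w :> R by rewrite indicE.
exists b'; split.
  apply: eq_bernoulli; rewrite -[LHS]/(P (b @^-1` [set true])).
  rewrite preB probability_Rintegral//; congr EFin.
  transitivity (\int[P]_w (\1_setT w * \1_B w)).
    by apply: eq_Rintegral => w _; rewrite indicT mul1r.
  rewrite -(BZ 0 setT (lexx 0) (FT 0 (lexx 0))).
  transitivity (\int[P]_w (cst z w)).
    apply: ae_eq_Rintegral => //.
      by apply: measurable_funM => //; exact: mZ.
    by apply: filterS Z0z => w; rewrite indicT mul1r => ->.
  exact: Rintegral_cst_probability.
move=> t t0; split; first exact: adaptedZ.
  apply: (@bounded_integrable _ _ _ _ 1); first exact: mZ.
  by move=> w; have /andP[? ?] := Z01 t w t0; rewrite ger0_norm.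
move=> A FA; have mA : measurable A by case: filtF => _ [/(_ t t0) + _]; exact.
have restr (f : T -> R) : measurable_fun setT f -> (forall w, `|f w| <= 1) ->
    (\int[P]_(w in A) (f w)%:E = (\int[P]_w (\1_A w * f w))%:E)%E.
  move=> mf f1; rewrite integral_mkcond EFin_Rintegral; last first.
    apply: (@bounded_integrable _ _ _ _ 1).
      by apply: measurable_funM => //; exact: measurable_indic.
    by move=> w; rewrite normrM mulr_ile1// normr_indic_le1.
  by apply: eq_integral => w _; rewrite epatch_indic/= -EFinM mulrC.
rewrite restr; [|exact: mZ|]; last first.
  by move=> w; have /andP[? ?] := Z01 t w t0; rewrite ger0_norm.
rewrite (BZ t A t0 FA).
under [RHS]eq_integral do rewrite bE.
rewrite restr//.
exact: normr_indic_le1.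
Qed.
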